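(* Let $a_1,\dots,a_{n+1}\ge2$ be integers and $\epsilon_1,\dots,\epsilon_n\in\{\pm1\}$, and let $M$ be the Seifert fibered space $\Sigma(0;(0,1),(a_1,\epsilon_1),\dots,(a_n,\epsilon_n),(a_{n+1},1))$. Suppose that $\pi_1(M)$ is of infinite order. Then $$W:=\rho_1(x_1^{-1}\rho_1^{-1}x_1)\,\rho_2(x_2^{-1}\rho_2^{-1}x_2)\cdots\rho_n(x_n^{-1}\rho_n^{-1}x_n)$$ is a taut identity of the presentation $$\langle x_1,\dots,x_n\mid r_i:=(x_ix_{i+1}\cdots x_nx_1\cdots x_{i-1})^{-a_{n+1}}x_i^{\epsilon_ia_i}\ (1\le i\le n)\rangle .$$
   Context: The Seifert fibered space $M$ over $S^2$ has fundamental group presented by $\langle x_1,\dots,x_{n+1},h\mid hx_ih^{-1}x_i^{-1},\ x_i^{a_i}h^{\epsilon_i}\ (i\le n),\ x_{n+1}^{a_{n+1}}h,\ x_1\cdots x_{n+1}\rangle$. Identity: for a presentation $\langle x_1,\dots,x_m\mid r_1,\dots,r_m\rangle$ let $F$ be the free group on the $x_i$, $P$ the free group on symbols $\rho_1,\dots,\rho_m$, and $\psi:P*F\to F$ the homomorphism with $\psi(\rho_j)=r_j$, $\psi(x_i)=x_i$. An identity is an $s\in\ker\psi$ that can be written as $\prod_k\omega_k\rho_{j_k}^{\epsilon_k}\omega_k^{-1}$ with $\omega_k\in F$, $\epsilon_k\in\{\pm1\}$. Taut: let $s=\prod_{k=1}^{2m}w_k\rho_{j_k}^{\epsilon_k}w_k^{-1}$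 be an identity; write $r_{j_k}^{\epsilon_k}=a_{k,1}^{\epsilon_{k,1}}\cdots a_{k,\ell_k}^{\epsilon_{k,\ell_k}}$ and $w_k=b_{k,1}^{\eta_{k,1}}\cdots b_{k,n_k}^{\eta_{k,n_k}}$ with $a_{k,i},b_{k,i}\in\{x_1,\dots,x_m\}$ and exponents $\pm1$. Let $D_k$ be an $\ell_k$-gon whose $i$-th edge is labeled $a_{k,i}^{\epsilon_{k,i}}$, and $I_k=[0,n_k]$ with $[i-1,i]$ labeled $b_{k,i}^{\eta_{k,i}}$. A syllable is a self-bijection $\mathcal I$ of $\bigcup_{k=1}^{2m}\{(k,1),\dots,(k,\ell_k)\}$ with $a_{\mathcal I(i,j)}=a_{i,j}$ and $\epsilon_{\mathcal I(i,j)}=-\epsilon_{i,j}$. Given $\mathcal I$, let $\sim$ identify the edge $(i,j)$ with the edge $\mathcal I(i,j)$ (compatibly with labels). The identity $s$ is taut if for some syllable the quotient $\bigsqcup_{k=1}^{2m}D_k/\!\sim$ is homeomorphic to $S^2$ and there are continuous maps $\kappa_k:I_k\to\bigsqcup_i\partial D_i/\!\sim$ (injective) and $\lambda_k:[0,\ell_k]\to\partial D_k/\!\sim$ (injective on $[0,\ell_k)$) such that for each $k$: $\kappa_k([i-1,i])$ is an edge labeled by $b_{k,i}$, compatibly with orientations; $\lambda_k([j-1,j])$ is the $j$-th edge of $D_k$, compatibly with orientations; and $\kappa_k(n_k)=\lambda_k(0)=\lambda_k(\ell_k)$. *)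

(* Defs.v *)
From HB Require Import structures.
From Stdlib Require Import Relation_Operators.
From mathcomp Require Import all_boot all_order all_algebra generic_quotient.
From mathcomp Require Import all_classical all_reals all_analysis.

Set Implicit Arguments.
Unset Strict Implicit.
Unset Printing Implicit Defensive.

Import Order.TTheory GRing.Theory Num.Theory.
Import numFieldNormedType.Exports.

Local Open Scope classical_set_scope.

(* In a word, (x, true) is the letter x and (x, false) the letter x^-1. *)
Definition linv (T : Type) (c : T * bool) : T * bool := (c.1, ~~ c.2).

Definition signed (G : groupType) (g : G) (b : bool) : G :=
  if b then g else (g^-1)%g.

Definition zexpg (G : groupType) (g : G) (z : int) : G :=
  match z with Posz k => (g ^+ k)%g | Negz k => (g ^- k.+1)%g end.

Section FreeGroup.
Variable T : choiceType.
Implicit Types (c d : T * bool) (u v w : seq (T * bool)).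

Definition reduced w : bool := sorted (fun c d => d != linv c) w.

Record free_group := FreeGroup { fword :> seq (T * bool); _ : reduced fword }.

HB.instance Definition _ := [isSub for fword].
HB.instance Definition _ := [Choice of free_group by <:].

Definition push c w : seq (T * bool) :=
  if w is d :: w' then if d == linv c then w' else c :: w else [:: c].

Definition reduce_onto w v : seq (T * bool) := foldr push v w.

Lemma linvK : involutive (@linv T).
Proof. by case=> x b; rewrite /linv negbK. Qed.

Lemma reduced_push c w : reduced w -> reduced (push c w).
Proof.
case: w => [|d w] //= rdw; case: eqP => [_|/eqP ne]; first exact: path_sorted rdw.
by rewrite /reduced /= ne.
Qed.

Lemma reduced_onto w v : reduced v -> reduced (reduce_onto w v).
Proof. by move=> rv; elim: w => //= c w; exact: reduced_push. Qed.

Lemma pushK c w : reduced w -> push c (push (linv c) w) = w.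
Proof.
case: w => [|d w] /=; first by rewrite eqxx.
rewrite linvK => rdw; case: eqP => [<-|_]; last by rewrite /= eqxx.
by case: w rdw => [|d' w] //= /andP[/negPf->].
Qed.

Lemma reduce_push c w v : reduced w -> reduced v ->
  reduce_onto (push c w) v = push c (reduce_onto w v).
Proof.
case: w => [|d w] //= rdw rv; case: eqP => [->|//].
by rewrite pushK //; exact: reduced_onto.
Qed.

Lemma reduce_ontoA u v w : reduced v -> reduced w ->
  reduce_onto u (reduce_onto v w) = reduce_onto (reduce_onto u v) w.
Proof.
move=> rv rw; elim: u => //= c u ->.
by rewrite reduce_push //; exact: reduced_onto.
Qed.

Lemma reduce_onto0 w : reduced w -> reduce_onto w [::] = w.
Proof.
elim: w => //= c w IH rcw; rewrite (IH (path_sorted rcw)).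
by case: w rcw {IH} => //= d w /andP[/negPf->].
Qed.

Definition winv w : seq (T * bool) := rev (map (@linv T) w).

Lemma winvK : involutive winv.
Proof. by move=> w; rewrite /winv map_rev revK mapK //; exact: linvK. Qed.

Lemma reduced_winv w : reduced w -> reduced (winv w).
Proof.
rewrite /reduced /winv rev_sorted sorted_map; apply: sub_sorted => c d /=.
by rewrite !linvK eq_sym.
Qed.

Lemma reduce_winv w : reduce_onto (winv w) w = [::].
Proof.
elim: w => //= c w IH.
rewrite /winv /= rev_cons /reduce_onto foldr_rcons /=.
by rewrite linvK eqxx.
Qed.

Definition fg_one : free_group := @FreeGroup [::] isT.
Definition fg_mul (u v : free_group) : free_group :=
  FreeGroup (reduced_onto u (valP v)).
Definition fg_inv (u : free_group) : free_group :=
  FreeGroup (reduced_winv (valP u)).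

Lemma fg_mulA : associative fg_mul.
Proof.
by move=> u v w; apply: val_inj; apply: reduce_ontoA; exact: valP.
Qed.

Lemma fg_mul1 : left_id fg_one fg_mul.
Proof. by move=> u; apply: val_inj. Qed.

Lemma fg_mulr1 : right_id fg_one fg_mul.
Proof. by move=> u; apply: val_inj; apply: reduce_onto0; exact: valP. Qed.

Lemma fg_mulV : left_inverse fg_one fg_inv fg_mul.
Proof. by move=> u; apply: val_inj; apply: reduce_winv. Qed.

Lemma fg_mulrV : right_inverse fg_one fg_inv fg_mul.
Proof.
by move=> u; apply: val_inj; rewrite /= -{1}(winvK u); apply: reduce_winv.
Qed.

HB.instance Definition _ := isGroup.Build free_group
  fg_mulA fg_mul1 fg_mulr1 fg_mulV fg_mulrV.

Definition fgen (x : T) : free_group := @FreeGroup [:: (x, true)] isT.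

Section Lift.
Variables (G : groupType) (f : T -> G).

Definition flift (u : free_group) : G :=
  (\prod_(c <- fword u) signed (f c.1) c.2)%g.

Lemma flift_morph : monoid.monoid_morphism flift.
Proof.
split; first by rewrite /flift big_nil.
move=> u v; rewrite /flift /=; elim: (fword u) => [|c w IH] /=.
  by rewrite big_nil mul1g.
rewrite big_cons -mulgA -IH; case: (reduce_onto w v) => [|d t] /=.
  by rewrite big_cons !big_nil.
case: eqP => [->|_]; last by rewrite big_cons.
by rewrite big_cons mulgA /linv /=; case: c.2;
  rewrite /= ?mulgV ?mulVg mul1g.
Qed.

HB.instance Definition _ := isUMagmaMorphism.Build free_group G flift flift_morph.

End Lift.
End FreeGroup.

Section PresentedGroup.
Variables (T : choiceType) (rels : set (free_group T)).
Local Notation F := (free_group T).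

Definition normal_subgroup (N : set F) : Prop :=
  [/\ N 1%g, forall g h, N g -> N h -> N (g * h^-1)%g
    & forall g h, N g -> N (h * g * h^-1)%g].

Definition normal_closure : set F := smallest normal_subgroup rels.

(* The elements are the cosets of the normal closure of the relators. *)
Definition presented_group : set (set F) :=
  range (fun g : F => [set h : F | normal_closure (g^-1 * h)%g]).

End PresentedGroup.

Section Identity.
Variables (m : nat) (r : 'I_m -> free_group 'I_m).

(* The free product P * F is the free group on the disjoint union of the two
   bases: [inl j] is rho_j and [inr i] is x_i. *)
Definition PF : groupType := free_group ('I_m + 'I_m)%type.

Definition rho (j : 'I_m) : PF := fgen (inl j : ('I_m + 'I_m)%type).
Definition xPF (i : 'I_m) : PF := fgen (inr i : ('I_m + 'I_m)%type).

Definition F_to_PF : free_group 'I_m -> PF := flift xPF.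

Definition psi : PF -> free_group 'I_m :=
  flift (fun c : ('I_m + 'I_m)%type =>
    match c with inl j => r j | inr i => fgen i end).

(* [Factor w j b] stands for w rho_j w^-1 if b = true and for
   w rho_j^-1 w^-1 if b = false. *)
Record factor := Factor {
  fconj : free_group 'I_m ; fidx : 'I_m ; fsign : bool }.

Definition factor_val (f : factor) : PF :=
  (F_to_PF (fconj f) * signed (rho (fidx f)) (fsign f)
     * (F_to_PF (fconj f))^-1)%g.

Definition factors_val (fs : seq factor) : PF :=
  (\prod_(f <- fs) factor_val f)%g.

Definition is_identity (s : PF) : Prop :=
  psi s = 1%g /\ exists fs : seq factor, s = factors_val fs.

Definition factor_rel (f : factor) : free_group 'I_m :=
  signed (r (fidx f)) (fsign f).

End Identity.

Local Open Scope ring_scope.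

Section Polygons.
Variables (R : realType).

Definition closed_disk : set (R * R) := [set p | p.1 ^+ 2 + p.2 ^+ 2 <= 1].

Definition sphere2 : set (R * R * R) :=
  [set p | p.1.1 ^+ 2 + p.1.2 ^+ 2 + p.2 ^+ 2 = 1].

Definition homeomorphic (X Y : topologicalType) : Prop :=
  exists (f : X -> Y) (g : Y -> X),
    [/\ cancel f g, cancel g f, continuous f & continuous g].

(* The l-gon is the closed unit disk whose boundary circle is cut, from (1, 0)
   counterclockwise, into l arcs of equal length, numbered from 0; this also
   covers l = 1 and l = 2. *)
Definition polygon : topologicalType := set_type closed_disk.

Definition circle_pt (l : nat) (t : R) : R * R :=
  (cos (2 * pi * t / l%:R), sin (2 * pi * t / l%:R)).

Lemma circle_pt_disk l t : closed_disk (circle_pt l t).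
Proof. by rewrite /closed_disk /= cos2Dsin2. Qed.

Definition boundary_pt (l : nat) (t : R) : polygon :=
  SigSub (mem_set (circle_pt_disk l t)).

Variables (T : eqType) (N : nat) (bword : 'I_N -> seq (T * bool)).

Definition edge : Type := {k : 'I_N & 'I_(size (bword k))}.

Definition edge_label (e : edge) : T * bool :=
  tnth (in_tuple (bword (tag e))) (tagged e).

Definition polygons : topologicalType := {k : 'I_N & polygon}.

Definition in_polygon (k : 'I_N) (p : polygon) : polygons :=
  existT (fun=> polygon) k p.

Definition edge_pt (e : edge) (t : R) : polygons :=
  in_polygon (tag e) (boundary_pt (size (bword (tag e))) ((tagged e)%:R + t)).

Definition syllable (I : edge -> edge) : Prop :=
  bijective I /\
  forall e, (edge_label (I e)).1 = (edge_label e).1 /\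
            (edge_label (I e)).2 = ~~ (edge_label e).2.

Variable I : edge -> edge.

(* The labels of e and I e are opposite, so that gluing compatibly with the
   labels reverses the boundary orientation. *)
Definition edge_glue (x y : polygons) : Prop :=
  exists (e : edge) (t : R),
    [/\ 0 <= t <= 1, x = edge_pt e t & y = edge_pt (I e) (1 - t)].

Definition glue_rel (x y : polygons) : bool :=
  `[< clos_refl_sym_trans polygons edge_glue x y >].

Lemma glue_rel_refl : reflexive glue_rel.
Proof. by move=> x; apply/asboolP; exact: rst_refl. Qed.

Lemma glue_rel_sym : symmetric glue_rel.
Proof. by move=> x y; apply/asboolP/asboolP; exact: rst_sym. Qed.

Lemma glue_rel_trans : transitive glue_rel.
Proof.
by move=> y x z /asboolP xy /asboolP yz; apply/asboolP; exact: rst_trans yz.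
Qed.

Definition glue_equiv := EquivRel _ glue_rel_refl glue_rel_sym glue_rel_trans.

Definition glued_quot : quotType polygons := {eq_quot glue_equiv}%qT.

Definition glued : topologicalType := quotient_topology glued_quot.

Definition to_glued (x : polygons) : glued := (\pi_glued_quot x)%qT.

Definition glued_boundary (k : 'I_N) : set glued :=
  [set to_glued (in_polygon k p) | p in
    [set p : polygon | (set_val p).1 ^+ 2 + (set_val p).2 ^+ 2 = 1]].

(* On [s, s + 1] the path g runs once along the image of the edge e, in the
   direction of the boundary orientation iff b = true; phi is an increasing
   reparametrization. *)
Definition runs_along (g : R -> glued) (s : R) (e : edge) (b : bool) : Prop :=
  exists phi : R -> R,
    [/\ {within `[s, s + 1], continuous phi},
        {in `[s, s + 1] &, {homo phi : x y / x < y}},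
        phi s = 0, phi (s + 1) = 1
      & {in `[s, s + 1], forall t,
          g t = to_glued (edge_pt e (if b then phi t else 1 - phi t))}].

Definition conjugator_path (w : seq (T * bool)) (kappa : R -> glued) : Prop :=
  [/\ {within `[0, (size w)%:R], continuous kappa},
      {in `[0, (size w)%:R] &, injective kappa},
      {in `[0, (size w)%:R], forall t, exists k, glued_boundary k (kappa t)}
    & forall i : 'I_(size w), exists e : edge,
        (edge_label e).1 = (tnth (in_tuple w) i).1 /\
        runs_along kappa i%:R e
          ((edge_label e).2 == (tnth (in_tuple w) i).2)].

Definition boundary_path (k : 'I_N) (lambda : R -> glued) : Prop :=
  let l := size (bword k) in
  [/\ {within `[0, l%:R], continuous lambda},
      {in `[0, l%:R[ &, injective lambda},
      {in `[0, l%:R], forall t, glued_boundary k (lambda t)}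
    & forall j : 'I_l,
        runs_along lambda j%:R
          (existT (fun k => 'I_(size (bword k))) k j) true].

End Polygons.

(* The words of r_j^{+-1} and w_k are the reduced words carried by the elements
   of [free_group]. *)
Definition taut (R : realType) (m : nat) (r : 'I_m -> free_group 'I_m)
    (fs : seq (factor m)) : Prop :=
  let f k := tnth (in_tuple fs) k in
  let bword k := fword (factor_rel r (f k)) in
  size fs = (2 * m)%N /\
  exists I : edge bword -> edge bword,
    [/\ syllable I,
        homeomorphic (glued R I) (set_type (@sphere2 R))
      & exists kappa lambda : 'I_(size fs) -> R -> glued R I,
          forall k : 'I_(size fs),
            let n := size (fword (fconj (f k))) in
            let l := size (bword k) in
            [/\ conjugator_path (fword (fconj (f k))) (kappa k),
                boundary_path k (lambda k),
                kappa k n%:R = lambda k 0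
              & lambda k 0 = lambda k l%:R]].

(* Tautness depends on the way fs in which s is written as a product. *)
Definition taut_identity (R : realType) (m : nat)
    (r : 'I_m -> free_group 'I_m) (s : PF m) (fs : seq (factor m)) : Prop :=
  [/\ is_identity r s, s = factors_val fs & taut R r fs].

Section Seifert.
Variables (n : nat) (a : 'I_n.+1 -> nat) (eps : 'I_n -> int).

Definition emb (i : 'I_n) : 'I_n.+1 := widen_ord (leqnSn n) i.

(* [Some i] is x_{i+1} for i = 0, ..., n, and [None] is h. *)
Definition seifert_x (i : 'I_n.+1) : free_group (option 'I_n.+1) :=
  fgen (Some i : option 'I_n.+1).
Definition seifert_h : free_group (option 'I_n.+1) :=
  fgen (None : option 'I_n.+1).

Inductive seifert_relator : free_group (option 'I_n.+1) -> Prop :=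
| seifert_central (i : 'I_n.+1) : seifert_relator
    (seifert_h * seifert_x i * seifert_h^-1 * (seifert_x i)^-1)%g
| seifert_fiber (i : 'I_n) : seifert_relator
    (seifert_x (emb i) ^+ a (emb i) * zexpg seifert_h (eps i))%g
| seifert_last : seifert_relator
    (seifert_x ord_max ^+ a ord_max * seifert_h)%g
| seifert_total : seifert_relator (\prod_(i < n.+1) seifert_x i)%g.

(* The fundamental group of
   Sigma(0; (0,1), (a_1,eps_1), ..., (a_n,eps_n), (a_{n+1},1)). *)
Definition seifert_pi1 : set (set (free_group (option 'I_n.+1))) :=
  presented_group seifert_relator.

(* [rot i (enum 'I_n)] lists i, i+1, ..., n-1, 0, ..., i-1. *)
Definition rel_r (i : 'I_n) : free_group 'I_n :=
  (zexpg (\prod_(j <- rot i (enum 'I_n)) fgen j) (- (a ord_max)%:Z)%R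
     * zexpg (fgen i) (eps i * (a (emb i))%:Z)%R)%g.

Definition W : PF n :=
  (\prod_(i < n) (rho i * ((xPF i)^-1 * (rho i)^-1 * xPF i)))%g.

Definition W_factors : seq (factor n) :=
  flatten [seq [:: Factor 1%g i true; Factor (fgen i)^-1%g i false]
          | i <- enum 'I_n].

End Seifert.

(* Main.v *)
From Stdlib Require Import Relation_Operators.
Require Import Defs.
From mathcomp Require Import all_boot all_order all_algebra.
From mathcomp Require Import all_classical all_reals all_analysis.
From mathcomp Require Import ring lra zify.

(** The sphere is tiled by the 2n polygons of the identity as follows; indices
    run from 0 and are taken modulo n, a_j stands for [a (emb j)], A for
    [a ord_max], and P_j for the product x_j x_(j+1) ... x_(j-1) of all the
    generators.  Draw n meridians M_0, ..., M_(n-1) from the south pole S to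
    the north pole N, and divide M_j into a_j edges labelled by x_j.  Cut the
    lune between M_(j-1) and M_j in two by a chord which reads P_j^-A from N
    down to S.  The face between the chord and M_j then reads
    P_j^-A x_j^(eps_j a_j), the unreduced form of r_j, and the face between
    M_j and the chord of the next lune reads x_j^(-eps_j a_j) P_(j+1)^A, a
    cyclic conjugate of r_j^-1.

    When eps_j = 1 the last letter of P_j^-A cancels the first letter of
    x_j^a_j.  In the picture the last edge of the chord is folded onto the
    first edge of M_j, so the chord ends at the first vertex of M_j instead of
    S; the same cancellation in r_j^-1 makes the chord of the next lune start
    at the last vertex of M_j before N.  As a_j >= 2, the first of these
    vertices lies in the closed southern half and the second in the closed
    northern half, so chords never degenerate and the reduced words are exactly
    the boundary words of the faces.  Every edge of the tiling borders two
    faces and is run through by them in opposite directions: exchanging the two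
    is the syllable.  All of this is encoded by [oedge_at], which sends an edge
    of a polygon to an oriented edge of the tiling, and its inverse [face_of].

    To realize the picture, a lune is charted by the convex plane region
    |x| <= 1 - y^2.  Meridians become its two parabolic sides, the chord a line
    segment, and both faces convex regions, so that coning from an interior
    point extends any parametrization of the boundary of a face to a chart of
    the polygon ([cone_chart], [face_chart], [face_map]).  The map [wrap] rolls
    the n charts around the sphere.  The resulting map [develop] from the
    disjoint union of the polygons onto the sphere identifies two points
    exactly when the gluing does ([develop_fib]); by compactness the glued
    space is homeomorphic to the sphere.  Since [develop] is injective on each
    closed polygon, the boundary paths and the conjugating paths, which consist
    of at most one edge, are embedded.

    That W is an identity is a telescoping product: r_j (x_j^-1 r_j^-1 x_j)
    equals P_j^-A P_(j+1)^A because x_j^-1 P_j x_j = P_(j+1).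

    The infinite fundamental group rules out n = 0, where the glued space is
    empty, and n = 1 with eps = 1, where the relator is a power of x_0 with
    exponent a_0 - A and the group is cyclic of order a_0 + A. *)

Set Implicit Arguments.
Unset Strict Implicit.
Unset Printing Implicit Defensive.

Import Order.TTheory GRing.Theory Num.Theory numFieldNormedType.Exports.

Local Open Scope classical_set_scope.
Local Open Scope ring_scope.

(** * Compact quotients *)

Lemma hausdorff_set_type (T : topologicalType) (A : set T) :
  hausdorff_space T -> hausdorff_space (set_type A).
Proof.
move=> hT x y xy; apply: val_inj; apply: hT => U V Ux Vy.
have cv : continuous (set_val : set_type A -> T) by exact: initial_continuous.
have [z [Uz Vz]] := xy _ _ (cv x U Ux) (cv y V Vy).
by exists (set_val z).
Qed.

Lemma continuous_set_type (S T : topologicalType) (A : set T) (f : S -> set_type A) :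
  continuous (fun x => set_val (f x)) -> continuous f.
Proof.
move=> cf; apply/continuousP => U [V oV <-].
by move/continuousP: cf => /(_ V oV).
Qed.

Lemma closed_image (S T : topologicalType) (f : S -> T) (A : set S) :
  continuous f -> hausdorff_space T -> compact [set: S] -> closed A ->
  closed (f @` A).
Proof.
move=> cf hT cS cA; apply: compact_closed => //; apply: continuous_compact.
  exact: continuous_subspaceT.
by apply: (subclosed_compact cA cS).
Qed.

(** A continuous surjection from a compact set onto a Hausdorff space is a
    quotient map, so maps out of the target may be defined by formulas on the
    source.  Maps out of a polygon are obtained in this way from polar
    coordinates. *)
Lemma continuous_descend (Z X Y : topologicalType) (Q : set Z) (p : Z -> X) (q : Z -> Y) :
  compact Q -> continuous p -> continuous q -> hausdorff_space X ->
  (forall x, exists2 z, Q z & p z = x) ->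
  (forall z z', Q z -> Q z' -> p z = p z' -> q z = q z') ->
  exists2 f : X -> Y, continuous f & forall z, Q z -> f (p z) = q z.
Proof.
move=> cQ cp cq hX surj fib.
pose s x := projT1 (cid2 (surj x)).
have sQ x : Q (s x) by rewrite /s; case: cid2.
have sK x : p (s x) = x by rewrite /s; case: cid2.
exists (q \o s) => [|z Qz /=]; last by apply: fib; rewrite ?sK.
apply/continuous_closedP => A clA.
have -> : (q \o s) @^-1` A = p @` (Q `&` q @^-1` A).
  apply/seteqP; split => [x Ax|_ [z [Qz Az] <-]] /=; first by exists (s x).
  by rewrite -(fib z) ?sK.
apply: compact_closed => //; apply: continuous_compact.
  exact: continuous_subspaceT.
apply: compact_closedI => //.
by move/continuous_closedP: cq; exact.
Qed.

Lemma glue_rel_invariant (R : realType) (T : eqType) (N : nat)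
    (bword : 'I_N -> seq (T * bool)) (I : edge bword -> edge bword)
    (Y : Type) (f : polygons R N -> Y) :
  (forall x y, edge_glue I x y -> f x = f y) ->
  forall x y, glue_rel I x y -> f x = f y.
Proof.
move=> glf x y /asboolP.
by elim => {x y} [x y /glf//|//|//|x y z _ -> _ -> //].
Qed.

Lemma to_gluedE (R : realType) (T : eqType) (N : nat)
    (bword : 'I_N -> seq (T * bool)) (I : edge bword -> edge bword)
    (x y : polygons R N) :
  to_glued I x = to_glued I y <-> glue_rel I x y.
Proof. by split => [/eqmodP|xy]; [|apply/eqmodP]. Qed.

(** A continuous map from the polygons onto a Hausdorff space whose fibres are
    the gluing classes factors through a continuous bijection from the glued
    space, which is compact; such a bijection is closed. *)
Lemma glued_homeomorphic (R : realType) (T : eqType) (N : nat)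
    (bword : 'I_N -> seq (T * bool)) (I : edge bword -> edge bword)
    (Y : topologicalType) (f : polygons R N -> Y) :
  continuous f -> hausdorff_space Y ->
  compact [set: polygon R] ->
  (forall y, exists x, f x = y) ->
  (forall x y, edge_glue I x y -> f x = f y) ->
  (forall x y, f x = f y -> glue_rel I x y) ->
  homeomorphic (glued R I) Y.
Proof.
move=> cf hY cP surj glf fgl.
have piE := @to_gluedE R T N bword I.
have rel_f := glue_rel_invariant glf.
pose F (z : glued R I) := f (repr z).
have FE x : F (to_glued I x) = f x.
  by apply: rel_f; apply/piE; rewrite /to_glued reprK.
have cF : continuous F.
  apply/quotient_continuous.
  by rewrite (_ : _ \o _ = f) //; apply/funext => x; exact: FE.
pose G y := to_glued I (projT1 (cid (surj y))).
have FG : cancel G F by move=> y; rewrite /G FE; case: cid.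
have GF : cancel F G.
  move=> z; rewrite /G /F; case: cid => x /= fx.
  have -> : z = to_glued I (repr z) by rewrite /to_glued reprK.
  by apply/piE/fgl.
have cpt : compact [set: glued R I].
  have -> : [set: glued R I] = to_glued I @` [set: polygons R N].
    apply/seteqP; split => // z _; exists (repr z) => //.
    by rewrite /to_glued reprK.
  apply: continuous_compact.
    by apply: continuous_subspaceT; exact: (@pi_continuous _ (glued_quot R I)).
  apply: sigT_compact; [exact: finite_finset|by move=> _].
exists F, G; split => //; apply/continuous_closedP => A clA.
have -> : G @^-1` A = F @` A.
  apply/seteqP; split => [y Ay|_ [z Az <-]] /=; last by rewrite GF.
  by exists (G y) => //; rewrite FG.
exact: closed_image.
Qed.

(** * Continuity of real formulas *)

Section Continuity.
Variables (R : realType) (T : topologicalType).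
Implicit Types f g : T -> R.

Lemma continuous_fadd f g : continuous f -> continuous g ->
  continuous (fun x => f x + g x).
Proof. by move=> cf cg x; apply: cvgD; [exact: cf|exact: cg]. Qed.

Lemma continuous_fopp f : continuous f -> continuous (fun x => - f x).
Proof. by move=> cf x; apply: cvgN; exact: cf. Qed.

Lemma continuous_fmul f g : continuous f -> continuous g ->
  continuous (fun x => f x * g x).
Proof. by move=> cf cg x; apply: cvgM; [exact: cf|exact: cg]. Qed.

Lemma continuous_fmin f g : continuous f -> continuous g ->
  continuous (fun x => Num.min (f x) (g x)).
Proof. by move=> cf cg x; apply: continuous_min; [exact: cf|exact: cg]. Qed.

Lemma continuous_fmax f g : continuous f -> continuous g ->
  continuous (fun x => Num.max (f x) (g x)).
Proof. by move=> cf cg x; apply: continuous_max; [exact: cf|exact: cg]. Qed.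

Lemma continuous_fabs f : continuous f -> continuous (fun x => `|f x|).
Proof. by move=> cf x; apply: cvg_norm; exact: cf. Qed.

Lemma continuous_fpair (U V : topologicalType) (f : T -> U) (g : T -> V) :
  continuous f -> continuous g -> continuous (fun x => (f x, g x)).
Proof. by move=> cf cg x; apply: cvg_pair; [exact: cf|exact: cg]. Qed.

Lemma continuous_after (U V : topologicalType) (h : U -> V) (f : T -> U) :
  continuous h -> continuous f -> continuous (fun x => h (f x)).
Proof. by move=> ch cf x; apply: continuous_comp; [exact: cf|exact: ch]. Qed.

End Continuity.

(** Proves continuity of a formula by following its syntax tree. *)
Ltac cont :=
  repeat first
  [ match goal with |- continuous (fun _ => ?c) => move=> ?; exact: cvg_cst end
  | match goal with |- continuous (fun x => x) => move=> ?; exact: cvg_id end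
  | match goal with |- continuous fst => move=> ?; exact: cvg_fst end
  | match goal with |- continuous snd => move=> ?; exact: cvg_snd end
  | match goal with |- continuous (fun x => x.1) => move=> ?; exact: cvg_fst end
  | match goal with |- continuous (fun x => x.2) => move=> ?; exact: cvg_snd end
  | match goal with |- continuous (fun x => (@?f x, @?g x)) => apply: (@continuous_fpair _ _ _ f g) end
  | match goal with |- continuous (fun x => @?f x + @?g x) => apply: (@continuous_fadd _ _ f g) end
  | match goal with |- continuous (fun x => @?f x * @?g x) => apply: (@continuous_fmul _ _ f g) end
  | match goal with |- continuous (fun x => - @?f x) => apply: (@continuous_fopp _ _ f) end
  | match goal with |- continuous (fun x => @?f x ^+ 2) => apply: (@continuous_fmul _ _ f f) end
  | match goal with |- continuous (fun x => Num.min (@?f x) (@?g x)) => apply: (@continuous_fmin _ _ f g) end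
  | match goal with |- continuous (fun x => Num.max (@?f x) (@?g x)) => apply: (@continuous_fmax _ _ f g) end
  | match goal with |- continuous (fun x => `|@?f x|) => apply: (@continuous_fabs _ _ f) end
  | match goal with |- continuous (fun x => (@?f x).1) => apply: (@continuous_after _ _ _ fst f) end
  | match goal with |- continuous (fun x => (@?f x).2) => apply: (@continuous_after _ _ _ snd f) end
  | match goal with |- continuous (fun x => cos (@?f x)) =>
      apply: (@continuous_after _ _ _ (@cos _) f); [exact: continuous_cos|] end
  | match goal with |- continuous (fun x => sin (@?f x)) =>
      apply: (@continuous_after _ _ _ (@sin _) f); [exact: continuous_sin|] end
  | match goal with |- continuous (fun x => Num.sqrt (@?f x)) =>
      apply: (@continuous_after _ _ _ (@Num.sqrt _) f); [exact: sqrt_continuous|] end ].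

(** * Polar coordinates on the disk *)

Section Circle.
Variable R : realType.
Implicit Types x y t : R.

Lemma cos_eq1 x : `|x| <= 2 * pi -> cos x = 1 -> x = 0 \/ `|x| = 2 * pi.
Proof.
move=> xpi cx1; have [->|x0] := eqVneq x 0; [by left|right].
have x0' : 0 < `|x| by rewrite normr_gt0.
have hx : `|x| = (`|x| / 2) *+ 2 by rewrite -[RHS]mulr_natr divfK.
have c2 : cos (`|x| / 2) ^+ 2 *+ 2 - 1 = 1 by rewrite -cos_mulr2n -hx cos_norm.
have s0 : sin (`|x| / 2) = 0.
  by apply/eqP; rewrite -sqrf_eq0 sin2cos2; apply/eqP; lra.
apply/eqP/contraT => ne.
have : 0 < sin (`|x| / 2).
  apply: sin_gt0_pi; apply/andP; split; first lra.
  by move: xpi; rewrite le_eqVlt (negPf ne) /=; lra.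
by rewrite s0 ltxx.
Qed.

Lemma circle_inj x y : `|x - y| <= 2 * pi -> cos x = cos y -> sin x = sin y ->
  x = y \/ `|x - y| = 2 * pi.
Proof.
move=> xy cxy sxy; case: (cos_eq1 xy) => [|xy0|]; last by right.
  by rewrite cosB cxy sxy -!expr2 cos2Dsin2.
by left; apply/eqP; rewrite -subr_eq0 xy0.
Qed.

Lemma circle_surj x y : x ^+ 2 + y ^+ 2 = 1 ->
  exists t, [/\ 0 <= t <= 2 * pi, x = cos t & y = sin t].
Proof.
move=> xy1.
have y2 : 1 - x ^+ 2 = y ^+ 2 by lra.
have x1 : -1 <= x <= 1.
  by have := sqr_ge0 y => ?; apply/andP; split; nra.
have xK : cos (acos x) = x by rewrite acosK // in_itv.
have a0 := acos_ge0 x1; have api := acos_lepi x1.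
have sE := sin_acos x1; rewrite y2 sqrtr_sqr in sE.
have p0 := pi_gt0 R.
have [y0|y0] := leP 0 y.
  exists (acos x); split => //; first by rewrite a0; lra.
  by rewrite sE ger0_norm.
exists (- acos x + pi *+ 2); split.
- by rewrite -mulr_natr; apply/andP; split; lra.
- by rewrite cosD2pi cosN.
- by rewrite sinD2pi sinN sE ltr0_norm // opprK.
Qed.

(** The radius is clamped so that the map is defined and continuous on the whole
    plane; on [square] it is the radius.  The shift [s] chooses which point of
    the boundary has parameter 0. *)
Definition polar_pt (l : nat) (s : R) (z : R * R) : R * R :=
  let r := Num.min `|z.1| 1 in
  (r * (circle_pt l (z.2 + s)).1, r * (circle_pt l (z.2 + s)).2).

Lemma polar_pt_disk l s z : closed_disk (polar_pt l s z).
Proof.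
rewrite /closed_disk /polar_pt /circle_pt /= !exprMn -mulrDr cos2Dsin2 mulr1.
by rewrite expr_le1 // ?le_min ?normr_ge0 // ge_min lexx orbT.
Qed.

Definition polar l s z : polygon R := SigSub (mem_set (polar_pt_disk l s z)).

Lemma continuous_polar l s : continuous (polar l s).
Proof.
apply: continuous_set_type; rewrite (_ : (fun z => _) = polar_pt l s) //.
by rewrite /polar_pt /circle_pt /=; cont.
Qed.

Definition square (l : nat) : set (R * R) := `[0, 1] `*` `[0, l%:R].

Lemma compact_square l : compact (square l).
Proof. by apply: compact_setX; exact: segment_compact. Qed.

Lemma squareP l z : square l z <-> (0 <= z.1 <= 1) /\ (0 <= z.2 <= l%:R).
Proof. by rewrite /square /= !in_itv. Qed.

Lemma polar_boundary l s t : polar l s (1, t) = boundary_pt l (t + s).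
Proof. by apply: val_inj; rewrite /= /polar_pt /= normr1 minxx !mul1r. Qed.

Lemma boundary_ptD l t : (0 < l)%N -> boundary_pt l (t + l%:R) = boundary_pt l t.
Proof.
move=> l0; apply: val_inj; rewrite /= /circle_pt mulrDr mulrDl mulfK; last first.
  by rewrite pnatr_eq0 -lt0n.
by rewrite [X in _ + X]mulr_natl cosD2pi sinD2pi.
Qed.

(** The angle given by [circle_surj] may fall short of the shift; one more turn
    then brings the parameter back into range. *)
Lemma polar_surj l s (p : polygon R) : (0 < l)%N -> 0 <= s <= l%:R ->
  exists2 z, square l z & polar l s z = p.
Proof.
move=> l0 sl; case: p => -[x y] pd; have /set_mem := pd; rewrite /closed_disk /= => pd1.
have p0 := pi_gt0 R; have l0' : 0 < l%:R :> R by rewrite ltr0n.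
pose r := Num.sqrt (x ^+ 2 + y ^+ 2).
have r2 : r ^+ 2 = x ^+ 2 + y ^+ 2 by rewrite sqr_sqrtr // addr_ge0 ?sqr_ge0.
have r0 : 0 <= r := sqrtr_ge0 _.
have r1 : r <= 1 by have := sqr_ge0 (r - 1) => ?; nra.
have [t [t01 xt yt]] : exists t, [/\ 0 <= t <= 2 * pi, x = r * cos t & y = r * sin t].
  have [r00|rn0] := eqVneq r 0.
    exists 0; move: r2; rewrite r00 expr0n /= => /esym/eqP.
    rewrite paddr_eq0 ?sqr_ge0 // !sqrf_eq0 => /andP[/eqP -> /eqP ->].
    by rewrite !mul0r; split => //; apply/andP; split; lra.
  have [t [t01 xt yt]] : exists t, [/\ 0 <= t <= 2 * pi, x / r = cos t & y / r = sin t].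
    by apply: circle_surj; rewrite !expr_div_n -mulrDl -r2 divff // sqrf_eq0.
  by exists t; split => //; [rewrite -xt|rewrite -yt]; rewrite mulrC divfK.
have key (u : R) : 0 <= u <= l%:R -> circle_pt l (u + s) = (cos t, sin t) ->
    exists2 z, square l z & polar l s z = SigSub pd.
  move=> ul cu; exists (r, u); first by apply/squareP; rewrite /= r0 r1.
  apply: val_inj; rewrite /= /polar_pt cu /= ger0_norm // xt yt.
  by congr (_ * _, _ * _); exact/min_idPl.
pose u := l%:R * t / (2 * pi).
have uE : 2 * pi * u / l%:R = t by rewrite /u; field; lra.
have ul : 0 <= u <= l%:R.
  rewrite /u; apply/andP; split; first by rewrite divr_ge0 //; nra.
  by rewrite ler_pdivrMr; nra.
have [su|us] := leP s u.
  by apply: (key (u - s)); [apply/andP; split; lra|rewrite subrK /circle_pt uE].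
apply: (key (u - s + l%:R)); first by apply/andP; split; lra.
rewrite (_ : u - s + l%:R + s = u + l%:R); last by ring.
by have /(congr1 val)/= := boundary_ptD u l0; rewrite /circle_pt uE.
Qed.

Lemma polar_fib l s z z' : (0 < l)%N -> square l z -> square l z' ->
  polar l s z = polar l s z' ->
  z.1 = z'.1 /\ (z.1 = 0 \/ z.2 = z'.2 \/ `|z.2 - z'.2| = l%:R).
Proof.
move=> l0 /squareP[/andP[r0 r1] /andP[t0 t1]] /squareP[/andP[r0' r1'] /andP[t0' t1']].
case: z z' r0 r1 t0 t1 r0' r1' t0' t1' => [r t] [r' t'] /= r0 r1 t0 t1 r0' r1' t0' t1'.
move=> /(congr1 val) /=; rewrite /polar_pt /= (ger0_norm r0) (ger0_norm r0').
rewrite (_ : Num.min r 1 = r); last exact/min_idPl.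
rewrite (_ : Num.min r' 1 = r'); last exact/min_idPl.
have p0 := pi_gt0 R; have l0' : 0 < l%:R :> R by rewrite ltr0n.
set c := circle_pt l (t + s); set c' := circle_pt l (t' + s).
have c1 : c.1 ^+ 2 + c.2 ^+ 2 = 1 by rewrite /= cos2Dsin2.
have c1' : c'.1 ^+ 2 + c'.2 ^+ 2 = 1 by rewrite /= cos2Dsin2.
case => e1 e2.
have rr : r = r'.
  apply/eqP; rewrite -(@eqrXn2 _ 2) //; apply/eqP.
  by rewrite -[LHS]mulr1 -[RHS]mulr1 -{1}c1 -c1' !mulrDr -!exprMn e1 e2.
split=> //; have [->|rn0] := eqVneq r 0; [by left|right].
rewrite -rr in e1 e2; move/(mulfI rn0) in e1; move/(mulfI rn0) in e2.
have dE : 2 * pi * (t + s) / l%:R - 2 * pi * (t' + s) / l%:R = 2 * pi / l%:R * (t - t').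
  by field; lra.
have q0 : 0 < 2 * pi / l%:R :> R by apply: divr_gt0 => //; lra.
have absE : `|2 * pi * (t + s) / l%:R - 2 * pi * (t' + s) / l%:R| = 2 * pi / l%:R * `|t - t'|.
  by rewrite dE normrM gtr0_norm.
have := circle_inj _ e1 e2; rewrite absE => -[].
- have : `|t - t'| <= l%:R by rewrite ler_norml; apply/andP; split; lra.
  by move=> /(ler_wpM2l (ltW q0)); rewrite divfK // gt_eqF.
- move/eqP; rewrite -subr_eq0 dE mulf_eq0 gt_eqF //= subr_eq0 => /eqP ->; by left.
- move=> h; right; apply: (mulfI (lt0r_neq0 q0)). by rewrite h divfK // gt_eqF.
Qed.

Lemma continuous_boundary_pt l : continuous (boundary_pt l : R -> polygon R).
Proof.
apply: continuous_set_type; rewrite (_ : (fun t => _) = circle_pt l) //.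
by rewrite /circle_pt; cont.
Qed.

Lemma boundary_pt_inj l t t' : (0 < l)%N -> 0 <= t <= l%:R -> 0 <= t' <= l%:R ->
  boundary_pt l t = boundary_pt l t' -> t = t' \/ `|t - t'| = l%:R.
Proof.
move=> l0 tl tl' e; have [] := @polar_fib l 0 (1, t) (1, t') l0.
- by apply/squareP; rewrite /= lexx ler01.
- by apply/squareP; rewrite /= lexx ler01.
- by rewrite !polar_boundary !addr0.
- by move=> _ [/= /eqP|//]; rewrite oner_eq0.
Qed.

Lemma compact_polygon : compact [set: polygon R].
Proof.
have -> : [set: polygon R] = polar 1 0 @` square 1.
  apply/seteqP; split => // p _.
  by have [|z Qz <-] := @polar_surj 1 0 p isT; [rewrite lexx ler01|exists z].
apply: continuous_compact; last exact: compact_square.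
by apply: continuous_subspaceT; exact: continuous_polar.
Qed.

Lemma hausdorff_polygon : hausdorff_space (polygon R).
Proof. by apply: hausdorff_set_type; exact: (@norm_hausdorff R (R * R)%type). Qed.

End Circle.

(** * Coning a polygon over a convex region *)

Section Cone.
Variable R : realType.
Implicit Types (c p : R * R) (r t : R).

(** The point at parameter [r] on the ray from [c] through [p]. *)
Definition ray c r p : R * R := (c.1 + r * (p.1 - c.1), c.2 + r * (p.2 - c.2)).

Lemma ray_ray c r r' p : ray c r (ray c r' p) = ray c (r * r') p.
Proof. by rewrite /ray /=; congr (_, _); ring. Qed.

Lemma ray0 c p : ray c 0 p = c.
Proof. by case: c => x y; rewrite /ray /= !mul0r !addr0. Qed.

Lemma ray1 c p : ray c 1 p = p.
Proof. by case: p => x y; rewrite /ray /= !mul1r !subrKC. Qed.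

Lemma circle_pt_period l s t t' : (0 < l)%N -> `|t - t'| = l%:R ->
  circle_pt l (t + s) = circle_pt l (t' + s) :> R * R.
Proof.
move=> l0; wlog tt : t t' / t' <= t.
  move=> wl; have [|/ltW] := leP t' t; first exact: wl.
  by rewrite distrC => tt e; rewrite (wl t' t).
rewrite ger0_norm ?subr_ge0 // => e; rewrite (_ : t + s = t' + s + l%:R).
  exact: (congr1 val (boundary_ptD (t' + s) l0)).
by rewrite -e; ring.
Qed.

Variables (l : nat) (s : R) (m : R * R -> R) (c : R * R) (B : R).
Variable gam : R -> R * R.
Hypotheses (l_gt0 : (0 < l)%N) (sl : 0 <= s <= l%:R).
Hypothesis m_cont : continuous m.
Hypothesis m_concave : forall p r, 0 <= r <= 1 ->
  (1 - r) * m c + r * m p <= m (ray c r p).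
Hypothesis m_bounded : forall p, 0 <= m p -> `|p.1| <= B /\ `|p.2| <= B.
Hypothesis m_center : 0 < m c.
Hypothesis gam_cont : continuous gam.
Hypothesis gam_closed : gam 0 = gam l%:R.
Hypothesis gam_inj : forall t t', 0 <= t <= l%:R -> 0 <= t' <= l%:R ->
  gam t = gam t' -> t = t' \/ `|t - t'| = l%:R.
Hypothesis gam_im : forall p, m p = 0 <-> exists2 t, 0 <= t <= l%:R & gam t = p.

(** Moving away from the centre, the concave function [m] becomes negative since
    its nonnegativity region is bounded, so the ray through [p] crosses the
    zero set of [m] at or beyond [p]. *)
Lemma cone_surj p : 0 <= m p -> exists2 z, square l z & ray c z.1 (gam z.2) = p.
Proof.
move=> mp; have [->|pc] := eqVneq p c.
  by exists (0, 0); [apply/squareP; rewrite /= lexx ler01 ler0n|rewrite ray0].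
have [L L1 mL] : exists2 L, 1 <= L & m (ray c L p) < 0.
  have [d [dc d0]] : exists d, (d = p.1 - c.1 \/ d = p.2 - c.2) /\ d != 0.
    have [e1|ne1] := eqVneq p.1 c.1; last first.
      by exists (p.1 - c.1); split; [left|rewrite subr_eq0].
    have [e2|ne2] := eqVneq p.2 c.2; last first.
      by exists (p.2 - c.2); split; [right|rewrite subr_eq0].
    by move: pc; case: (p) (c) e1 e2 => ? ? [? ?] /= -> ->; rewrite eqxx.
  pose M := `|B| + `|c.1| + `|c.2| + 1.
  have M1 : 1 <= M by have := normr_ge0 B; have := normr_ge0 c.1; have := normr_ge0 c.2; rewrite /M; lra.
  pose L := Num.max 1 (M / `|d|).
  exists L; first by rewrite le_max lexx.
  have d0' : 0 < `|d| by rewrite normr_gt0.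
  have Ld : M <= `|L * d|.
    rewrite normrM (ger0_norm (_ : 0 <= L)) ?le_max ?ler01 //.
    by rewrite -ler_pdivrMr // le_max lexx orbT.
  have big (x : R) : `|x| <= M - 1 - `|B| -> B < `|x + L * d|.
    move=> xM; have := ler_normD (x + L * d) (- x); rewrite addrAC subrr add0r normrN.
    by have := ler_norm B; lra.
  rewrite ltNge; apply/negP => /m_bounded[] /=; rewrite -?dc.
  have := normr_ge0 c.1; have := normr_ge0 c.2 => ? ?.
  by case: dc => <-; [move=> + _|move=> _]; rewrite leNgt big // /M; lra.
have [t tL mt] : exists2 t, t \in `[1, L] & m (ray c t p) = 0.
  apply: (@IVT R (fun t => m (ray c t p))) => //.
    apply: continuous_subspaceT; apply: (@continuous_after _ _ _ m (fun t => ray c t p)) => //.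
    by rewrite /ray; cont.
  by rewrite ray1 ge_min le_max mp orbC (ltW mL).
have [u ul ub] := (gam_im _).1 mt.
have t1 : 1 <= t by have := tL; rewrite in_itv => /andP[].
have t0 : 0 < t := lt_le_trans ltr01 t1.
exists (t^-1, u); last by rewrite /= ub ray_ray mulVf ?gt_eqF // ray1.
by apply/squareP; rewrite /= ul invr_ge0 ltW //= invf_le1.
Qed.

(** If two boundary points lie on one ray from the centre, the nearer one is at a
    fraction q of the way to the farther one; concavity gives
    0 >= (1 - q) m(c), hence q = 1. *)
Lemma cone_inj z z' : square l z -> square l z' ->
  ray c z.1 (gam z.2) = ray c z'.1 (gam z'.2) -> polar l s z = polar l s z'.
Proof.
wlog rr : z z' / z.1 <= z'.1.
  move=> wl Qz Qz' e; have [|/ltW] := leP z.1 z'.1 => rr; first exact: wl.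
  by rewrite (wl z' z).
case: z z' rr => [r t] [r' t'] /= rr /squareP[/andP[/= r0 r1] tl] /squareP[/= /andP[r0' r1'] tl'] e.
have gam0 u : 0 <= u <= l%:R -> m (gam u) = 0.
  by move=> ul; apply/gam_im; exists u.
have [r00|rn0] := eqVneq r' 0.
  have rr0 : r = 0 by apply/eqP; rewrite eq_le r0 -{1}r00 rr.
  apply: val_inj; rewrite /= /polar_pt /= r00 rr0 normr0.
  by rewrite (_ : Num.min 0 1 = 0) ?mul0r //; apply/min_idPl.
have r'0 : 0 < r' by rewrite lt_neqAle eq_sym rn0.
have q01 : 0 <= r / r' <= 1 by rewrite divr_ge0 //= ler_pdivrMr // mul1r.
have eg : gam t' = ray c (r / r') (gam t).
  by rewrite mulrC -ray_ray e ray_ray mulVf // ray1.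
have q1 : r / r' = 1.
  have := m_concave (gam t) q01; rewrite -eg !gam0 // mulr0 addr0.
  rewrite pmulr_lle0 // subr_le0 => q1; apply/eqP; rewrite eq_le q1.
  by case/andP: q01 => _ ->.
have rE : r = r' by rewrite -[r](@divfK _ r') // q1 mul1r.
rewrite q1 ray1 in eg; apply: val_inj; rewrite /= /polar_pt /= rE.
suff [-> ->] : circle_pt l (t + s) = circle_pt l (t' + s) by [].
by case: (gam_inj tl tl' (esym eg)) => [->//|]; exact: circle_pt_period.
Qed.

(** The Alexander trick for a convex region given as the nonnegativity region of
    a concave function: any parametrization of its boundary by the boundary of
    the disk extends to a chart of the region, by coning. *)
Lemma cone_chart : exists f : polygon R -> R * R,
  [/\ continuous f, injective f,
      forall p, (0 <= m p) <-> exists x, f x = p &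
      forall t, 0 <= t <= l%:R -> f (boundary_pt l (t + s)) = gam t].
Proof.
pose q z : R * R := ray c z.1 (gam z.2).
have [f cf fq] : exists2 f, continuous f & forall z, square l z -> f (polar l s z) = q z.
  apply: (continuous_descend (@compact_square R l) (@continuous_polar R l s)).
  - have c2 : continuous (fun z : R * R => gam z.2).
      by apply: continuous_after => //; cont.
    by rewrite /q /ray; cont.
  - exact: hausdorff_polygon.
  - by move=> p; exact: polar_surj.
  - move=> [r t] [r' t'] Qz Qz' /(polar_fib l_gt0 Qz Qz') /=; rewrite /q /=.
    case=> <- [->|[->//|tt]]; first by rewrite !ray0.
    move: Qz Qz' => /squareP[_ /= /andP[? ?]] /squareP[_ /= /andP[? ?]].
    suff -> : gam t = gam t' by [].
    have [t't|tt'] := leP t' t.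
      move: tt; rewrite ger0_norm ?subr_ge0 // => tt.
      have -> : t = l%:R by lra.
      by have -> : t' = 0 by lra.
    move: tt; rewrite ltr0_norm ?subr_lt0 // => tt.
    have -> : t' = l%:R by lra.
    by have -> : t = 0 by lra.
have fS x : exists2 z, square l z & polar l s z = x by exact: polar_surj.
exists f; split => //.
- move=> x y; have [z Qz <-] := fS x; have [z' Qz' <-] := fS y.
  by rewrite !fq //; exact: cone_inj.
- move=> p; split.
    by move=> /cone_surj[z Qz <-]; exists (polar l s z); rewrite fq.
  case=> x <-; have [z Qz <-] := fS x; rewrite fq // /q.
  have [z1 z2] := (squareP _ _).1 Qz.
  apply: le_trans (m_concave (gam z.2) z1).
  rewrite (gam_im (gam z.2)).2; last by exists z.2.
  rewrite mulr0 addr0; apply: mulr_ge0; last exact: ltW.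
  by rewrite subr_ge0; case/andP: z1.
- move=> t tl; rewrite -polar_boundary fq; first by rewrite /q ray1.
  by apply/squareP; rewrite /= lexx ler01.
Qed.

End Cone.

(** * Lunes and their chords *)

Section Face.
Variable R : realType.
Implicit Types (p : R * R) (b c t x y : R).

(** In the chart of a lune the second coordinate is the height on the sphere,
    and the lune is the region where [lune_gap] is nonnegative, bounded by the
    graphs [left_side] and [right_side] over -1 <= y <= 1. *)
Definition lune_gap p : R := 1 - p.2 ^+ 2 - `|p.1|.
Definition left_side y : R * R := (- (1 - y ^+ 2), y).
Definition right_side y : R * R := (1 - y ^+ 2, y).
(** The chord from the point of height b on the left side to the point of height
    -c on the right side.  The affine form [chord_form] vanishes on its line
    and is positive above it. *)
Definition chord b c t : R * R :=
  (t * (2 - b ^+ 2 - c ^+ 2) - (1 - b ^+ 2), b - t * (b + c)).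
Definition chord_form b c p : R :=
  (2 - b ^+ 2 - c ^+ 2) * (p.2 - b) + (b + c) * (p.1 + (1 - b ^+ 2)).

Lemma sqr_le1 x : 0 <= x <= 1 -> x ^+ 2 <= 1.
Proof. by case/andP => x0 x1; rewrite expr_le1. Qed.

Lemma lune_gap_concave p q r : 0 <= r <= 1 ->
  (1 - r) * lune_gap p + r * lune_gap q <= lune_gap (ray p r q).
Proof.
case/andP => r0 r1; rewrite /lune_gap /ray /=.
have h : `|p.1 + r * (q.1 - p.1)| <= (1 - r) * `|p.1| + r * `|q.1|.
  rewrite (_ : p.1 + r * (q.1 - p.1) = (1 - r) * p.1 + r * q.1); last by ring.
  apply: le_trans (ler_normD _ _) _; rewrite !normrM.
  by rewrite (ger0_norm r0) ger0_norm // subr_ge0.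
have : 0 <= (r * (1 - r)) * (p.2 - q.2) ^+ 2.
  by apply: mulr_ge0; [apply: mulr_ge0 => //; lra|exact: sqr_ge0].
nra.
Qed.

Lemma chord_form_ray b c p q r :
  chord_form b c (ray p r q) = (1 - r) * chord_form b c p + r * chord_form b c q.
Proof. by rewrite /chord_form /ray /=; ring. Qed.

Lemma chord_form_left b c y : chord_form b c (left_side y) =
  (y - b) * ((1 - b) * (1 - c) + (1 - c ^+ 2) + (b + c) * (1 + y)).
Proof. by rewrite /chord_form /=; ring. Qed.

Lemma chord_form_right b c y : chord_form b c (right_side y) =
  (y + c) * ((1 - b) * (1 - c) + (1 - b ^+ 2) + (b + c) * (1 - y)).
Proof. by rewrite /chord_form /=; ring. Qed.

Lemma chord_form_chord b c t : chord_form b c (chord b c t) = 0.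
Proof. by rewrite /chord_form /chord /=; ring. Qed.

(** The half turn of the lune exchanges the two faces cut out by a chord, so
    only the upper face needs to be studied. *)
Lemma chord_formN b c p : chord_form c b (- p.1, - p.2) = - chord_form b c p.
Proof. by rewrite /chord_form /=; ring. Qed.

Lemma chordN b c t : chord b c (1 - t) = (- (chord c b t).1, - (chord c b t).2).
Proof. by rewrite /chord /=; congr (_, _); ring. Qed.

Lemma lune_gap_left y : -1 <= y <= 1 -> lune_gap (left_side y) = 0.
Proof. by move=> h; rewrite /lune_gap /= normrN ger0_norm; nra. Qed.

Lemma lune_gap_right y : -1 <= y <= 1 -> lune_gap (right_side y) = 0.
Proof. by move=> h; rewrite /lune_gap /= ger0_norm; nra. Qed.

(** The boundary of the lune consists of its two sides. *)
Lemma lune_gap0 p : lune_gap p = 0 ->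
  -1 <= p.2 <= 1 /\ (p = left_side p.2 \/ p = right_side p.2).
Proof.
case: p => x y; rewrite /lune_gap /= => e.
have y2 : y ^+ 2 <= 1 by have := normr_ge0 x; lra.
split; first by apply/andP; split; nra.
have xE : `|x| = 1 - y ^+ 2 by lra.
have [x0|x0] := leP 0 x; [right|left]; rewrite /left_side /right_side.
  by move: xE; rewrite ger0_norm // => <-.
by move: xE; rewrite ltr0_norm // => <-; rewrite opprK.
Qed.

Section Chord.
Variables b c : R.
Hypotheses (b01 : 0 <= b <= 1) (c01 : 0 <= c <= 1).

Lemma lune_gap_chord t : 0 <= t <= 1 -> 0 <= lune_gap (chord b c t).
Proof.
case/andP: (b01) => b0 b1; case/andP: (c01) => c0 c1.
move=> t01; rewrite /lune_gap /chord /= subr_ge0 ler_norml.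
set Q : R := b + c; set P : R := 2 - b ^+ 2 - c ^+ 2.
have Q0 : 0 <= Q by rewrite /Q; lra.
have [c2 b2] : c ^+ 2 <= 1 /\ b ^+ 2 <= 1 by split; exact: sqr_le1.
have h1 : 0 <= P + 2 * b * Q - t * Q ^+ 2.
  have -> : P + 2 * b * Q - t * Q ^+ 2 = (2 - 2 * c ^+ 2) + (1 - t) * Q ^+ 2.
    by rewrite /P /Q; ring.
  by apply: addr_ge0; [lra|apply: mulr_ge0; [lra|exact: sqr_ge0]].
have h2 : 0 <= P + 2 * c * Q - (1 - t) * Q ^+ 2.
  have -> : P + 2 * c * Q - (1 - t) * Q ^+ 2 = (2 - 2 * b ^+ 2) + t * Q ^+ 2.
    by rewrite /P /Q; ring.
  by apply: addr_ge0; [lra|apply: mulr_ge0; [lra|exact: sqr_ge0]].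
have t0 : 0 <= t by lra. have t1 : 0 <= 1 - t by lra.
have := mulr_ge0 t0 h1; have := mulr_ge0 t1 h2; rewrite /P /Q => g2 g1.
by apply/andP; split; lra.
Qed.

(** The line that carries the chord leaves the lune at the ends of the chord:
    beyond them, one of the two concave functions 1 - y^2 + x and 1 - y^2 - x,
    restricted to the line, is negative. *)
Lemma chord_surj p : 0 <= lune_gap p -> chord_form b c p = 0 ->
  exists2 t, 0 <= t <= 1 & chord b c t = p.
Proof.
case/andP: (b01) => b0 b1; case/andP: (c01) => c0 c1.
case: p => x y; rewrite /lune_gap /chord_form /= => gap.
set Q : R := b + c; set P : R := 2 - b ^+ 2 - c ^+ 2 => e.
have Q0 : 0 <= Q by rewrite /Q; lra.
have [c2 b2] : c ^+ 2 <= 1 /\ b ^+ 2 <= 1 by split; exact: sqr_le1.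
have P0 : 0 <= P by rewrite /P; lra.
have PQ : 1 <= P + Q by rewrite /P /Q; nra.
have D0 : 0 < P ^+ 2 + Q ^+ 2.
  have [PQ0|PQ0] := ltP 0 P; first by have := sqr_ge0 Q; nra.
  have Q1 : 0 < Q by lra.
  by have := sqr_ge0 P; nra.
pose t := (P * (x + (1 - b ^+ 2)) - Q * (y - b)) / (P ^+ 2 + Q ^+ 2).
have tD : t * (P ^+ 2 + Q ^+ 2) = P * (x + (1 - b ^+ 2)) - Q * (y - b).
  by rewrite /t divfK // gt_eqF.
have tx : t * P = x + (1 - b ^+ 2).
  apply: (mulIf (lt0r_neq0 D0)); rewrite mulrAC tD.
  transitivity (P ^+ 2 * (x + (1 - b ^+ 2)) - Q * (P * (y - b))); first by ring.
  have -> : P * (y - b) = - (Q * (x + (1 - b ^+ 2))) by lra.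
  by ring.
have ty : t * Q = - (y - b).
  apply: (mulIf (lt0r_neq0 D0)); rewrite mulrAC tD.
  transitivity (P * (Q * (x + (1 - b ^+ 2))) - Q ^+ 2 * (y - b)); first by ring.
  have -> : Q * (x + (1 - b ^+ 2)) = - (P * (y - b)) by lra.
  by ring.
have xE : x = t * P - (1 - b ^+ 2) by lra.
have yE : y = b - t * Q by lra.
have xa := ler_norm x; have xb := ler_norm (- x); rewrite normrN in xb.
exists t; last by rewrite /chord -/P -/Q -xE -yE.
have g1 : 0 <= t * (P + 2 * b * Q - t * Q ^+ 2).
  have -> : t * (P + 2 * b * Q - t * Q ^+ 2) = 1 - y ^+ 2 + x.
    by rewrite xE yE; ring.
  by lra.
have g2 : 0 <= (1 - t) * (P + 2 * c * Q - (1 - t) * Q ^+ 2).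
  have -> : (1 - t) * (P + 2 * c * Q - (1 - t) * Q ^+ 2) = 1 - y ^+ 2 - x.
    by rewrite xE yE /P /Q; ring.
  by lra.
have pos (u d : R) : 0 <= d -> u < 0 -> 0 < P + 2 * d * Q - u * Q ^+ 2.
  move=> d0 u0; have dQ : 0 <= d * Q by exact: mulr_ge0.
  have [PQ0|PQ0] := ltP 0 P; first by have := sqr_ge0 Q; nra.
  have Q1 : 0 < Q ^+ 2 by rewrite exprn_gt0 //; lra.
  by nra.
apply/andP; split; rewrite leNgt; apply/negP => tlt.
  by have := pos t b b0 tlt; nra.
have tlt' : 1 - t < 0 by lra.
by have := pos (1 - t) c c0 tlt'; nra.
Qed.

Lemma chord_inj t t' : chord b c t = chord b c t' -> t = t'.
Proof.
case/andP: (b01) => b0 b1; case/andP: (c01) => c0 c1.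
case; set Q : R := b + c; set P : R := 2 - b ^+ 2 - c ^+ 2 => e1 e2.
have PQ : P + Q != 0.
  have : 1 <= P + Q by rewrite /P /Q; nra.
  by move=> h; rewrite gt_eqF //; lra.
by apply: (mulIf PQ); lra.
Qed.

(** By the factorization of [chord_form] on the right side, a right-hand point
    above the southern end of the chord lies on the chord only if it is the
    north pole and the chord starts there. *)
Lemma right_chord t y : -1 <= y <= 1 -> - c < y -> right_side y = chord b c t ->
  [/\ b = 1, y = 1 & t = 0].
Proof.
case/andP: (b01) => b0 b1; case/andP: (c01) => c0 c1.
move=> y1 cy /[dup] e /(congr1 (chord_form b c)).
rewrite chord_form_chord chord_form_right => /eqP; rewrite mulf_eq0.
have -> /= : (y + c == 0) = false by apply/eqP; lra.
have h1 : 0 <= (1 - b) * (1 - c) by apply: mulr_ge0; lra.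
have h2 : 0 <= (b + c) * (1 - y) by apply: mulr_ge0; lra.
have h3 : b ^+ 2 <= 1 by nra.
move/eqP => h.
have bE : b = 1.
  have : (1 - b) * (1 + b) = 0.
    by apply/eqP; rewrite eq_le; apply/andP; split; nra.
  by move/eqP; rewrite mulf_eq0 => /orP[] /eqP; lra.
have y1' : y = 1.
  have : (b + c) * (1 - y) = 0 by lra.
  by move/eqP; rewrite mulf_eq0 => /orP[] /eqP; lra.
split => //; case: e => _; rewrite y1' bE => e.
have : t * (1 + c) = 0 by lra.
by move/eqP; rewrite mulf_eq0 => /orP[] /eqP; lra.
Qed.

End Chord.
End Face.

(** * The faces of a lune *)

Section FaceChart.
Variable R : realType.
Variables (d l2 l3 h1 h2 b c : R).
Hypotheses (b01 : 0 <= b <= 1) (c01 : 0 <= c <= 1).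
Hypotheses (d_ge0 : 0 <= d) (l2_gt0 : 0 < l2) (l3_gt0 : 0 < l3).
Hypotheses (h1_gt0 : 0 < h1) (h2_gt0 : 0 < h2).
Hypotheses (bE : 1 - h1 * d = b) (cE : 1 - h2 * l3 = - c).

Ltac face_facts := pose proof d_ge0; pose proof l2_gt0; pose proof l3_gt0;
  pose proof h1_gt0; pose proof h2_gt0; pose proof bE; pose proof cE.

Definition face_gap (p : R * R) : R := Num.min (lune_gap p) (chord_form b c p).

(** The boundary of the upper face from the north pole: down the left side to
    the chord for a time [d], along the chord for a time [l2], and up the right
    side for a time [l3].  Clamping each leg to its own time interval and
    adding the displacements gives a formula that is visibly continuous. *)
Definition face_curve (t : R) : R * R :=
  let left := left_side (1 - h1 * Num.min t d) in
  let mid := chord b c (Num.max 0 (Num.min 1 ((t - d) / l2))) in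
  let right := right_side (1 - h2 * (d + l2 + l3 - Num.max t (d + l2))) in
  (left.1 + (mid.1 - (chord b c 0).1) + (right.1 - (chord b c 1).1),
   left.2 + (mid.2 - (chord b c 0).2) + (right.2 - (chord b c 1).2)).

Lemma continuous_face_curve : continuous face_curve.
Proof. by rewrite /face_curve /left_side /right_side /chord /=; cont. Qed.

Lemma chord_start : chord b c 0 = left_side b.
Proof. by rewrite /chord /left_side; congr (_, _); ring. Qed.

Lemma chord_end : chord b c 1 = right_side (- c).
Proof. by rewrite /chord /right_side; congr (_, _); ring. Qed.

Lemma face_curve_left t : t <= d -> face_curve t = left_side (1 - h1 * t).
Proof.
face_facts.
move=> td; rewrite /face_curve.
have -> : Num.min t d = t by apply/min_idPl.
have -> : Num.max t (d + l2) = d + l2 by apply/max_idPr; lra.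
have -> : Num.max 0 (Num.min 1 ((t - d) / l2)) = 0.
  apply/max_idPl; rewrite ge_min; apply/orP; right.
  by rewrite ler_pdivrMr // mul0r; lra.
rewrite (_ : d + l2 + l3 - (d + l2) = l3); last by ring.
by rewrite cE chord_end !subrr !addr0 -surjective_pairing.
Qed.

Lemma face_curve_chord t : d <= t <= d + l2 -> face_curve t = chord b c ((t - d) / l2).
Proof.
face_facts.
case/andP => td tl; rewrite /face_curve.
have -> : Num.min t d = d by apply/min_idPr.
have -> : Num.max t (d + l2) = d + l2 by apply/max_idPr; lra.
have -> : Num.min 1 ((t - d) / l2) = (t - d) / l2.
  by apply/min_idPr; rewrite ler_pdivrMr // mul1r; lra.
have -> : Num.max 0 ((t - d) / l2) = (t - d) / l2.
  by apply/max_idPr; rewrite divr_ge0 //; lra.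
rewrite (_ : d + l2 + l3 - (d + l2) = l3); last by ring.
rewrite cE chord_end !subrr !addr0 bE chord_start.
by rewrite !subrKC -surjective_pairing.
Qed.

Lemma face_curve_right t : d + l2 <= t ->
  face_curve t = right_side (1 - h2 * (d + l2 + l3 - t)).
Proof.
face_facts.
move=> tl; rewrite /face_curve.
have -> : Num.min t d = d by apply/min_idPr; lra.
have -> : Num.max t (d + l2) = t by apply/max_idPl.
have -> : Num.min 1 ((t - d) / l2) = 1.
  by apply/min_idPl; rewrite ler_pdivlMr // mul1r; lra.
have -> : Num.max 0 (1 : R) = 1 by apply/max_idPr.
by rewrite bE chord_start !subrKC -surjective_pairing.
Qed.

Let L := d + l2 + l3.

Lemma face_curve_closed : face_curve 0 = face_curve L.
Proof.
face_facts.
rewrite face_curve_left // face_curve_right /L; last by lra.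
by rewrite subrr !mulr0 subr0 /left_side /right_side expr1n subrr oppr0.
Qed.

Lemma face_curve_cases t : 0 <= t <= L ->
  [\/ [/\ t <= d, b <= 1 - h1 * t <= 1 & face_curve t = left_side (1 - h1 * t)],
      [/\ d <= t <= d + l2, 0 <= (t - d) / l2 <= 1 &
          face_curve t = chord b c ((t - d) / l2)] |
      [/\ d + l2 < t, - c < 1 - h2 * (L - t) <= 1 &
          face_curve t = right_side (1 - h2 * (L - t))]].
Proof.
face_facts.
move=> t0L; have [td|dt] := leP t d.
  constructor 1; split => //; last exact: face_curve_left.
  by rewrite -bE; apply/andP; split; nra.
have [tl|lt] := leP t (d + l2).
  constructor 2; split; [lra| |apply: face_curve_chord; lra].
  by rewrite divr_ge0 ?ler_pdivrMr // ?mul1r; lra.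
constructor 3; split => //; last by apply: face_curve_right; lra.
have tL : t <= L by lra.
by rewrite -cE /L in tL *; apply/andP; split; nra.
Qed.

Lemma face_curve_gap t : 0 <= t <= L -> face_gap (face_curve t) = 0.
Proof.
face_facts.
case/andP: (b01) => b0 b1; case/andP: (c01) => c0 c1.
have bc1 : 0 <= (1 - b) * (1 - c) by apply: mulr_ge0; lra.
have b2 := sqr_le1 b01; have c2 := sqr_le1 c01.
rewrite /face_gap; case/face_curve_cases => -[_ /andP[y1 y2] ->].
- rewrite lune_gap_left; last by lra.
  apply/min_idPl; rewrite chord_form_left; apply: mulr_ge0; first lra.
  by have : 0 <= (b + c) * (1 + (1 - h1 * t)); [apply: mulr_ge0; lra|lra].
- rewrite chord_form_chord; apply/min_idPr; apply: lune_gap_chord => //.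
  exact/andP.
- rewrite lune_gap_right; last by lra.
  apply/min_idPl; rewrite chord_form_right; apply: mulr_ge0; first lra.
  by have : 0 <= (b + c) * (1 - (1 - h2 * (L - t))); [apply: mulr_ge0; lra|lra].
Qed.

(** Off the chord, the boundary of the face lies on a side of the lune, where
    [chord_form] is (y - b) or (y + c) times a nonnegative factor; its sign
    decides which part of the side belongs to the face. *)
Lemma face_gap0 p : face_gap p = 0 -> exists2 t, 0 <= t <= L & face_curve t = p.
Proof.
face_facts.
case/andP: (b01) => b0 b1; case/andP: (c01) => c0 c1 m0.
have onchord : 0 <= lune_gap p -> chord_form b c p = 0 ->
    exists2 t, 0 <= t <= L & face_curve t = p.
  move=> g0 f0; have [k k01 <-] := chord_surj b01 c01 g0 f0.
  have kl : 0 <= k * l2 <= l2 by apply/andP; split; nra.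
  exists (k * l2 + d); first by rewrite /L; lra.
  by rewrite face_curve_chord ?addrK ?mulfK ?gt_eqF //; lra.
have bc1 : 0 <= (1 - b) * (1 - c) by apply: mulr_ge0; lra.
have b2 := sqr_le1 b01; have c2 := sqr_le1 c01.
have : 0 <= lune_gap p /\ 0 <= chord_form b c p.
  by move: (lexx (0 : R)); rewrite -{2}m0 /face_gap le_min => /andP[].
case=> g0 f0; move: m0; rewrite /face_gap; case: (leP (lune_gap p)) => [_ g|_ f]; last exact: onchord.
have [f|fn] := eqVneq (chord_form b c p) 0; first by apply: onchord; rewrite ?g.
have {f0 fn} f0 : 0 < chord_form b c p by rewrite lt_neqAle eq_sym fn.
have [/andP[y1 y2] [] pE] := lune_gap0 g; set y : R := p.2 in y1 y2 pE; rewrite pE in f0 *.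
- rewrite chord_form_left in f0.
  have K0 : 0 <= (1 - b) * (1 - c) + (1 - c ^+ 2) + (b + c) * (1 + y).
    by have : 0 <= (b + c) * (1 + y); [apply: mulr_ge0; lra|lra].
  have yb : b < y.
    rewrite ltNge; apply/negP => yb; move: f0; rewrite ltNge; apply/negP; rewrite negbK.
    by apply: mulr_le0_ge0 => //; lra.
  have E : h1 * ((1 - y) / h1) = 1 - y by rewrite mulrC divfK // gt_eqF.
  have ht : 0 <= (1 - y) / h1 <= d.
    by rewrite divr_ge0 ?(ltW h1_gt0) ?ler_pdivrMr //=; lra.
  exists ((1 - y) / h1); first by rewrite /L; lra.
  rewrite face_curve_left; last by lra.
  by rewrite E subKr.
- rewrite chord_form_right in f0.
  have K0 : 0 <= (1 - b) * (1 - c) + (1 - b ^+ 2) + (b + c) * (1 - y).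
    by have : 0 <= (b + c) * (1 - y); [apply: mulr_ge0; lra|lra].
  have yc : - c < y.
    rewrite ltNge; apply/negP => yb; move: f0; rewrite ltNge; apply/negP; rewrite negbK.
    by apply: mulr_le0_ge0 => //; lra.
  have E : h2 * ((1 - y) / h2) = 1 - y by rewrite mulrC divfK // gt_eqF.
  have ht : 0 <= (1 - y) / h2 <= l3.
    by rewrite divr_ge0 ?(ltW h2_gt0) ?ler_pdivrMr //=; lra.
  exists (L - (1 - y) / h2); first by rewrite /L; lra.
  rewrite face_curve_right; last by rewrite /L; lra.
  by rewrite -/L (subKr L) E subKr.
Qed.

(** The nine pairs of legs are compared; distinct legs meet only at their common
    ends, and the first and last instants are both at the north pole. *)
Lemma face_curve_inj t t' : 0 <= t <= L -> 0 <= t' <= L ->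
  face_curve t = face_curve t' -> t = t' \/ `|t - t'| = L.
Proof.
face_facts.
wlog tt : t t' / t <= t'.
  move=> wl tL tL' e; have [|/ltW] := leP t t' => tt; first exact: wl.
  by have [->|] := wl t' t tt tL' tL (esym e); [left|rewrite distrC; right].
case/andP: (b01) => b0 b1; case/andP: (c01) => c0 c1 tL tL'.
have endpt : t = 0 -> t' = L -> `|t - t'| = L.
  by move=> -> ->; rewrite sub0r normrN ger0_norm // /L; lra.
case: (face_curve_cases tL) => -[t1 t2 ->]; case: (face_curve_cases tL') => -[t1' t2' ->].
- by case=> _ e; left; apply: (mulfI (lt0r_neq0 h1_gt0)); lra.
- case/andP: t1' => t1' _ /[dup] e [] _ ey; left.
  have : 0 <= (t' - d) / l2 * (b + c) by apply: mulr_ge0; lra.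
  move=> pos; have td : t = d by apply: (mulfI (lt0r_neq0 h1_gt0)); lra.
  have /(chord_inj b01 c01) : chord b c 0 = chord b c ((t' - d) / l2).
    by rewrite -e td bE chord_start.
  move/esym/eqP; rewrite mulf_eq0 invr_eq0 (gt_eqF l2_gt0) orbF subr_eq0.
  by move/eqP ->.
- case=> e1 e2; right; have : (1 - h1 * t) ^+ 2 = 1 by rewrite -e2 in e1; lra.
  move/eqP; rewrite sqrf_eq1 => /orP[] /eqP y1; last by exfalso; lra.
  apply: endpt; first by apply: (mulfI (lt0r_neq0 h1_gt0)); lra.
  by apply: (mulfI (lt0r_neq0 h2_gt0)); lra.
- by move=> _; left; lra.
- move/(chord_inj b01 c01)/(mulIf (invr_neq0 (lt0r_neq0 l2_gt0))) => e.
  by left; lra.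
- move=> e; right; have := @right_chord _ b c b01 c01 ((t - d) / l2) (1 - h2 * (L - t')).
  case=> //; [lra|by case/andP: t2'|move=> bb yy].
  move/eqP; rewrite mulf_eq0 invr_eq0 (gt_eqF l2_gt0) orbF subr_eq0 => /eqP td.
  have d0 : d = 0 by apply: (mulfI (lt0r_neq0 h1_gt0)); lra.
  apply: endpt; first by rewrite td.
  by apply: (mulfI (lt0r_neq0 h2_gt0)); lra.
- by move=> _; left; lra.
- by move=> _; left; lra.
- by case=> _ e; left; apply: (mulfI (lt0r_neq0 h2_gt0)); lra.
Qed.

(** The midpoint of the north pole and a point of the right side strictly above
    the chord: strict concavity of [lune_gap] moves it off the sides, and
    [chord_form] is positive as the mean of a positive and a nonnegative
    value. *)
Lemma face_center : exists p, 0 < face_gap p.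
Proof.
face_facts; case/andP: (b01) => b0 b1; case/andP: (c01) => c0 c1.
pose y : R := (1 - c) / 2.
exists ((1 - y ^+ 2) / 2, (1 + y) / 2); rewrite /face_gap lt_min; apply/andP; split.
  rewrite /lune_gap /= ger0_norm; last by have := @sqr_le1 _ y; rewrite /y; lra.
  rewrite (_ : _ - _ = (1 - y) ^+ 2 / 4); last by field.
  by apply: divr_gt0 => //; apply: exprn_gt0; rewrite /y; lra.
have -> : chord_form b c ((1 - y ^+ 2) / 2, (1 + y) / 2) =
    (chord_form b c (right_side y) + chord_form b c (right_side 1)) / 2.
  by rewrite /chord_form /=; field.
apply: divr_gt0 => //; rewrite !chord_form_right.
have bc1 : 0 <= (1 - b) * (1 - c) by apply: mulr_ge0; lra.
have b2 := sqr_le1 b01.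
have q1 : 0 < (1 - b) * (1 - c) + (1 - b ^+ 2) + (b + c) * (1 - y).
  have [b1'|b1'] := ltP b 1.
    have : 0 <= (b + c) * (1 - y) by apply: mulr_ge0; rewrite /y; lra.
    have : 0 < (1 - b) * (1 + b) by apply: mulr_gt0; lra.
    lra.
  have : 0 < (b + c) * (1 - y) by apply: mulr_gt0; rewrite /y; lra.
  lra.
have q2 : 0 <= (1 + c) * ((1 - b) * (1 - c) + (1 - b ^+ 2) + (b + c) * (1 - 1)).
  by apply: mulr_ge0; lra.
have : 0 < (y + c) * ((1 - b) * (1 - c) + (1 - b ^+ 2) + (b + c) * (1 - y)).
  by apply: mulr_gt0 => //; rewrite /y; lra.
lra.
Qed.

Lemma face_chart (l : nat) (s : R) : l%:R = L -> 0 <= s <= l%:R ->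
  exists f : polygon R -> R * R,
  [/\ continuous f, injective f,
      forall p, (0 <= lune_gap p /\ 0 <= chord_form b c p) <-> exists x, f x = p &
      [/\ forall t, 0 <= t <= d -> f (boundary_pt l (t + s)) = left_side (1 - h1 * t),
          forall t, d <= t <= d + l2 ->
            f (boundary_pt l (t + s)) = chord b c ((t - d) / l2) &
          forall t, d + l2 <= t <= L ->
            f (boundary_pt l (t + s)) = right_side (1 - h2 * (L - t))]].
Proof.
face_facts; move=> lL sl; have l0 : (0 < l)%N by rewrite -(ltr0n R) lL /L; lra.
have [p0 p0gap] := face_center.
have [||||||f [cf injf imf bdf]] :=
    @cone_chart R l s face_gap p0 1 face_curve l0 sl _ _ _ p0gap continuous_face_curve.
- by rewrite /face_gap /lune_gap /chord_form; cont.
- move=> p r r01; rewrite /face_gap le_min; apply/andP; split.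
    apply: le_trans (lune_gap_concave _ _ r01).
    case/andP: r01 => r0 r1; apply: lerD; apply: ler_wpM2l; rewrite ?subr_ge0 //.
      by rewrite ge_min lexx.
    by rewrite ge_min lexx.
  rewrite chord_form_ray.
  case/andP: r01 => r0 r1; apply: lerD; apply: ler_wpM2l; rewrite ?subr_ge0 //.
    by rewrite ge_min lexx orbT.
  by rewrite ge_min lexx orbT.
- move=> [x y]; rewrite /face_gap le_min /lune_gap /= => /andP[g _].
  have x0 := normr_ge0 x; have y0 := sqr_ge0 y; split; first lra.
  by rewrite ler_norml; apply/andP; split; nra.
- by rewrite lL; exact: face_curve_closed.
- by rewrite lL; exact: face_curve_inj.
- move=> p; rewrite lL; split; first exact: face_gap0.
  by case=> t tL <-; exact: face_curve_gap.
rewrite lL in bdf; exists f; split => //.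
  by move=> p; rewrite -imf /face_gap le_min; split => [[-> ->]|/andP].
split=> t ht; (rewrite bdf; last by move: ht; rewrite /L; lra).
- by apply: face_curve_left; lra.
- exact: face_curve_chord.
- by apply: face_curve_right; case/andP: ht.
Qed.

End FaceChart.

(** * Rolling the lunes around the sphere *)

Section Wrap.
Variable R : realType.
Implicit Types (p : R * R) (t x y : R).

(** The longitude: the chart of the lune j is stretched at each height so that
    its two sides become the meridians at 2 pi j / n and 2 pi (j + 1) / n. *)
Definition angle (n j : nat) p : R :=
  2 * pi * (j%:R + (p.1 / (1 - p.2 ^+ 2) + 1) / 2) / n%:R.

Definition wrap (n j : nat) p : R * R * R :=
  let rho := Num.sqrt (1 - p.2 ^+ 2) in
  (rho * cos (angle n j p), rho * sin (angle n j p), p.2).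

(** The longitude is undefined at the poles, but it is only used through a bounded
    function multiplied by the radius of the parallel, which tends to 0. *)
Lemma continuous_damped (h : R * R -> R) (trig : R -> R) :
  continuous trig -> (forall t, -1 <= trig t <= 1) ->
  (forall p, 0 < 1 - p.2 ^+ 2 -> {for p, continuous h}) ->
  continuous (fun p => Num.sqrt (1 - p.2 ^+ 2) * trig (h p)).
Proof.
move=> ctrig trig1 hp p.
have crho : continuous (fun p : R * R => Num.sqrt (1 - p.2 ^+ 2)) by cont.
have [y1|y1] := ltP 0 (1 - p.2 ^+ 2).
  apply: cvgM; first exact: crho.
  by apply: (@continuous_comp _ _ _ h trig); [exact: hp|exact: ctrig].
have rho0 : Num.sqrt (1 - p.2 ^+ 2) = 0 by apply: ler0_sqrtr.
rewrite /continuous_at rho0 mul0r.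
have rhoc : Num.sqrt (1 - q.2 ^+ 2) @[q --> p] --> (0 : R) by rewrite -rho0; exact: crho.
apply: (@squeeze_cvgr _ _ _ _ (fun q => - Num.sqrt (1 - q.2 ^+ 2))
    (fun q => Num.sqrt (1 - q.2 ^+ 2))) => //.
  near=> q; have := trig1 (h q); have := sqrtr_ge0 (1 - q.2 ^+ 2) => r0 /andP[u1 u2].
  by apply/andP; split; nra.
by rewrite -[X in _ --> X]oppr0; apply: cvgN.
Unshelve. all: by end_near.
Qed.

Lemma continuous_wrap n j : continuous (wrap n j).
Proof.
have ca p : 0 < 1 - p.2 ^+ 2 -> {for p, continuous (angle n j)}.
  move=> y1; rewrite /angle; apply: cvgM; last exact: cvg_cst.
  apply: cvgM; first exact: cvg_cst.
  apply: cvgD; first exact: cvg_cst.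
  apply: cvgM; last exact: cvg_cst.
  apply: cvgD; last exact: cvg_cst.
  apply: cvgM; first exact: cvg_fst.
  apply: cvgV; first by rewrite gt_eqF.
  have c : continuous (fun q : R * R => 1 - q.2 ^+ 2) by cont.
  exact: c.
rewrite /wrap; apply: continuous_fpair; last by cont.
apply: continuous_fpair; apply: continuous_damped => //.
- exact: continuous_cos.
- by move=> t; rewrite cos_geN1 cos_le1.
- exact: continuous_sin.
- by move=> t; rewrite sin_geN1 sin_le1.
Qed.

Lemma lune_gap_ge0 p : 0 <= lune_gap p ->
  [/\ p.2 ^+ 2 <= 1, -1 <= p.2 <= 1 & `|p.1| <= 1 - p.2 ^+ 2].
Proof.
rewrite /lune_gap => g; have x0 := normr_ge0 p.1.
have y2 : p.2 ^+ 2 <= 1 by lra.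
by split; [|apply/andP; split; nra|lra].
Qed.

Lemma wrap_sphere n j p : 0 <= lune_gap p -> sphere2 (wrap n j p).
Proof.
case/lune_gap_ge0 => y2 _ _; rewrite /sphere2 /wrap /= !exprMn -mulrDr cos2Dsin2 mulr1.
by rewrite sqr_sqrtr ?subr_ge0 // subrK.
Qed.

Lemma wrap_pole n n' j j' x x' y : y ^+ 2 = 1 -> wrap n j (x, y) = wrap n' j' (x', y).
Proof. by move=> y1; rewrite /wrap /= y1 subrr sqrtr0 !mul0r. Qed.

Lemma wrap_sides n j y : (j < n)%N ->
  wrap n j (right_side y) = wrap n (j.+1 %% n) (left_side y).
Proof.
move=> jn; have [y1|y1] := eqVneq (y ^+ 2) 1; first exact: wrap_pole.
have d0 : 1 - y ^+ 2 != 0 by rewrite subr_eq0 eq_sym.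
have n0 : n%:R != 0 :> R by rewrite pnatr_eq0 -lt0n (leq_ltn_trans _ jn).
have aR : angle n j (right_side y) = 2 * pi * j.+1%:R / n%:R.
  by rewrite /angle /= divff // -natr1; field.
have aL k : angle n k (left_side y) = 2 * pi * k%:R / n%:R.
  by rewrite /angle /= mulNr divff // addNr mul0r addr0.
rewrite /wrap aR aL /=; move: jn; rewrite leq_eqVlt => /predU1P[jn|jn].
  rewrite jn modnn mulr0 mul0r cos0 sin0 mulfK // [2 * pi]mulr_natl.
  by rewrite cos2pi sin2pi.
by rewrite modn_small.
Qed.

Lemma wrap_surj n (q : R * R * R) : (0 < n)%N -> sphere2 q ->
  exists j p, [/\ (j < n)%N, 0 <= lune_gap p & wrap n j p = q].
Proof.
case: q => -[x y] z n0; rewrite /sphere2 /= => q1.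
have p0 := pi_gt0 R; have n0' : 0 < n%:R :> R by rewrite ltr0n.
have x2 := sqr_ge0 x; have y2 := sqr_ge0 y; have z2 := sqr_ge0 z.
have [z1|z1] := eqVneq (z ^+ 2) 1.
  have /eqP : x ^+ 2 + y ^+ 2 = 0 by lra.
  rewrite paddr_eq0 // !sqrf_eq0 => /andP[/eqP -> /eqP ->].
  exists 0%N, (0, z); split => //; first by rewrite /lune_gap /= z1 normr0 subrr.
  by rewrite /wrap /= z1 subrr sqrtr0 !mul0r.
have D0 : 0 < 1 - z ^+ 2 by rewrite subr_gt0 lt_neqAle z1; lra.
pose rho : R := Num.sqrt (1 - z ^+ 2).
have rho0 : 0 < rho by rewrite sqrtr_gt0.
have rho2 : rho ^+ 2 = 1 - z ^+ 2 by rewrite sqr_sqrtr // ltW.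
have [t [t01 xt yt]] : exists t, [/\ 0 <= t <= 2 * pi, x / rho = cos t & y / rho = sin t].
  apply: circle_surj; rewrite !expr_div_n -mulrDl rho2.
  by rewrite (_ : x ^+ 2 + y ^+ 2 = 1 - z ^+ 2) ?divff ?gt_eqF //; lra.
have [t2|t2] := eqVneq t (2 * pi).
  (* the angle 2 pi is the right side of the last lune *)
  exists n.-1, (right_side z); split; first by rewrite prednK.
    by rewrite lune_gap_right //; apply/andP; split; nra.
  have aR : angle n n.-1 (right_side z) = t.
    rewrite /angle /= divff ?gt_eqF // t2.
    have -> : n.-1%:R = n%:R - 1 :> R by rewrite -subn1 natrB.
    by field; rewrite gt_eqF.
  by rewrite /wrap aR -xt -yt /= -/rho ![rho * _]mulrC !divfK ?gt_eqF.
pose u : R := n%:R * t / (2 * pi).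
have u0 : 0 <= u by apply: divr_ge0; nra.
have un : u < n%:R.
  rewrite /u ltr_pdivrMr; last lra.
  by rewrite ltr_pM2l // lt_neqAle t2; case/andP: t01.
pose j := Num.truncn u.
have /andP[ju uj] : j%:R <= u < j.+1%:R by apply: truncn_itv.
exists j, ((2 * (u - j%:R) - 1) * (1 - z ^+ 2), z); split.
- by rewrite -(ltr_nat R); apply: le_lt_trans un.
- rewrite /lune_gap /= normrM (gtr0_norm D0).
  have : `|2 * (u - j%:R) - 1| <= 1.
    by rewrite ler_norml; rewrite -natr1 in uj; apply/andP; split; lra.
  by move=> h; rewrite subr_ge0 ler_piMl // ltW.
- have aE : angle n j ((2 * (u - j%:R) - 1) * (1 - z ^+ 2), z) = t.
    by rewrite /angle /= mulfK ?gt_eqF // /u; field; lra.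
  by rewrite /wrap aE -xt -yt /= -/rho ![rho * _]mulrC !divfK ?gt_eqF.
Qed.

(** Two charted points have the same image if they are equal, or face each other
    on the common meridian of consecutive lunes, or are the same pole. *)
Lemma wrap_fib n j j' p p' : (j < n)%N -> (j' < n)%N ->
  0 <= lune_gap p -> 0 <= lune_gap p' -> wrap n j p = wrap n j' p' ->
  [\/ j = j' /\ p = p',
      exists y, [/\ -1 <= y <= 1, p = right_side y, p' = left_side y & j' = (j.+1 %% n)%N],
      exists y, [/\ -1 <= y <= 1, p' = right_side y, p = left_side y & j = (j'.+1 %% n)%N] |
      [/\ p = (0, p.2), p' = p & p.2 ^+ 2 = 1]].
Proof.
move=> jn jn' /lune_gap_ge0[y2 y1 xy] /lune_gap_ge0[y2' y1' xy'].
have p0 := pi_gt0 R; have n0' : 0 < n%:R :> R by rewrite ltr0n (leq_ltn_trans _ jn).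
case: p p' y2 y1 xy y2' y1' xy' => [x y] [x' y'] /= y2 y1 xy y2' y1' xy' [].
move=> e1 e2 yy; rewrite -{}yy in y1' y2' xy' e1 e2 *.
have [y11|yn1] := eqVneq (y ^+ 2) 1.
  constructor 4; move: xy xy'; rewrite y11 subrr !normr_le0 => /eqP -> /eqP ->.
  by [].
have D0 : 0 < 1 - y ^+ 2 by rewrite subr_gt0 lt_neqAle yn1; lra.
have rho0 : Num.sqrt (1 - y ^+ 2) != 0 by rewrite gt_eqF // sqrtr_gt0.
move/(mulfI rho0) in e1; move/(mulfI rho0) in e2.
pose sg (x : R) : R := (x / (1 - y ^+ 2) + 1) / 2.
have sg01 (u : R) : `|u| <= 1 - y ^+ 2 -> 0 <= sg u <= 1.
  rewrite ler_norml => /andP[h1 h2].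
  have : -1 <= u / (1 - y ^+ 2) <= 1.
    by rewrite ler_pdivlMr // ler_pdivrMr //; apply/andP; split; lra.
  by rewrite /sg; lra.
have sgK (u : R) : u = (2 * sg u - 1) * (1 - y ^+ 2) by rewrite /sg; field; lra.
have right_of (u : R) : sg u = 1 -> (u, y) = right_side y.
  by move=> u1; rewrite /right_side [in LHS](sgK u) u1; congr (_, _); ring.
have left_of (u : R) : sg u = 0 -> (u, y) = left_side y.
  by move=> u0; rewrite /left_side [in LHS](sgK u) u0; congr (_, _); ring.
have s01 := sg01 _ xy; have s01' := sg01 _ xy'.
have aE k (u : R) : angle n k (u, y) = 2 * pi / n%:R * (k%:R + sg u).
  by rewrite /angle /= -/(sg u) mulrAC.
rewrite !aE in e1 e2; set K : R := 2 * pi / n%:R in e1 e2.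
have K0 : 0 < K by apply: divr_gt0 => //; lra.
have Kn : K * n%:R = 2 * pi by rewrite divfK // gt_eqF.
have jn1 : j%:R + 1 <= n%:R :> R by rewrite natr1 ler_nat.
have jn1' : j'%:R + 1 <= n%:R :> R by rewrite natr1 ler_nat.
have j0 : 0 <= j%:R :> R by []. have j0' : 0 <= j'%:R :> R by [].
have := circle_inj _ e1 e2; rewrite -mulrBr normrM (gtr0_norm K0) -Kn => -[].
- by rewrite ler_pM2l // ler_norml; apply/andP; split; lra.
- move/(mulfI (lt0r_neq0 K0)) => e; have [jj|jj|jj] := ltngtP j j'.
  + have : j'%:R <= j.+1%:R :> R by rewrite -natr1; lra.
    rewrite ler_nat => jj'; have jE : j' = j.+1 by apply/eqP; rewrite eqn_leq jj' jj.
    constructor 2; exists y; split => //; last by rewrite jE modn_small -?jE.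
      by apply: right_of; move: e; rewrite jE -natr1; lra.
    by apply: left_of; move: e; rewrite jE -natr1; lra.
  + have : j%:R <= j'.+1%:R :> R by rewrite -natr1; lra.
    rewrite ler_nat => jj'; have jE : j = j'.+1 by apply/eqP; rewrite eqn_leq jj' jj.
    constructor 3; exists y; split => //; last by rewrite jE modn_small -?jE.
      by apply: right_of; move: e; rewrite jE -natr1; lra.
    by apply: left_of; move: e; rewrite jE -natr1; lra.
  + constructor 1; split => //; congr (_, _); rewrite (sgK x) (sgK x').
    by move: e; rewrite jj => /addrI ->.
- move/(mulfI (lt0r_neq0 K0)); have [d0|d0] := leP 0 (j%:R + sg x - (j'%:R + sg x')).
    rewrite ger0_norm // => e.
    have jE : j.+1 = n.
      by apply/eqP; rewrite eqn_leq jn -(ler_nat R) -natr1; lra.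
    have jE' : j' = 0%N by apply/eqP; rewrite -leqn0 -(ler_nat R); lra.
    constructor 2; exists y; split => //; last by rewrite jE jE' modnn.
      by apply: right_of; lra.
    by apply: left_of; lra.
  rewrite ltr0_norm // => e.
  have jE : j'.+1 = n.
    by apply/eqP; rewrite eqn_leq jn' -(ler_nat R) -natr1; lra.
  have jE' : j = 0%N by apply/eqP; rewrite -leqn0 -(ler_nat R); lra.
  constructor 3; exists y; split => //; last by rewrite jE jE' modnn.
    by apply: right_of; lra.
  by apply: left_of; lra.
Qed.

End Wrap.

Close Scope ring_scope.
Close Scope classical_set_scope.

(** * Combinatorics of the tiling *)

Section CyclicIndex.
Variable n : nat.
Hypothesis n_gt0 : 0 < n.

Definition succ_mod j := j.+1 %% n.
Definition pred_mod j := (j + n.-1) %% n.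

Lemma succ_mod_lt j : succ_mod j < n. Proof. exact: ltn_pmod. Qed.
Lemma pred_mod_lt j : pred_mod j < n. Proof. exact: ltn_pmod. Qed.

Lemma succ_modE j : j < n -> succ_mod j = if j.+1 == n then 0 else j.+1.
Proof.
move=> jn; rewrite /succ_mod; case: eqP => [->|jn']; first exact: modnn.
by rewrite modn_small; lia.
Qed.

Lemma pred_modE j : j < n -> pred_mod j = if j == 0 then n.-1 else j.-1.
Proof.
move=> jn; rewrite /pred_mod; case: eqP => [->|j0]; first by rewrite modn_small; lia.
rewrite (_ : j + n.-1 = j.-1 + n); last by lia.
by rewrite modnDr modn_small; lia.
Qed.

Lemma succ_modK j : j < n -> pred_mod (succ_mod j) = j.
Proof.
move=> jn; rewrite pred_modE ?succ_mod_lt // succ_modE //.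
by case: (_ =P n) => h /=; lia.
Qed.

Lemma pred_modK j : j < n -> succ_mod (pred_mod j) = j.
Proof.
move=> jn; rewrite succ_modE ?pred_mod_lt // pred_modE //.
by case: (j =P 0) => j0 /=; case: eqP => h; lia.
Qed.

End CyclicIndex.

(** The polygons are numbered from 0 to 2n - 1: 2j bounds r_j and 2j + 1 bounds
    r_j^-1.  The boolean [d j] tells whether eps_j = 1; as a number it counts
    the edges of the chord that are folded onto M_j at one end.  With a
    single generator and eps = 1 more letters would cancel; [d_n] excludes
    this. *)
Section Pattern.
Variables (n A : nat) (a : nat -> nat) (d : nat -> bool).
Hypotheses (n_gt0 : 0 < n) (A_ge2 : 2 <= A) (a_ge2 : forall j, 2 <= a j).
Hypothesis d_n : forall j, d j -> 1 < n.
Local Notation succ_mod := (succ_mod n).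
Local Notation pred_mod := (pred_mod n).
Local Notation pred_modK := (@pred_modK n n_gt0).
Local Notation succ_modK := (@succ_modK n n_gt0).
Local Notation succ_mod_lt := (@succ_mod_lt n n_gt0).
Local Notation pred_mod_lt := (@pred_mod_lt n n_gt0).

(** Besides M_(k./2), the face k meets the meridian M_(nbr k), on the other side
    of its lune. *)
Definition nbr (k : nat) := if odd k then succ_mod k./2 else pred_mod k./2.
(** The number of edges of the chord once both ends have been folded away. *)
Definition mid_len k := n * A - d (nbr k) - d k./2.
Definition face_len j := n * A + a j - (d j + d j).
(** Every even face has a vertex at N and every odd face has one at S, and its
    edges are counted from there.  The word of an even face also starts there;
    the word of an odd face starts earlier, by [shift] edges. *)
Definition shift k := if odd k then 1 + a k./2 - (d k./2 + d k./2) else 0.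

Definition letter_of j p : nat * bool :=
  if p < n * A - d j then ((j + n * A - 1 - p) %% n, false) else (j, d j).
Definition letter k p : nat * bool :=
  if odd k then linv (letter_of k./2 (face_len k./2 - 1 - p)) else letter_of k./2 p.

(** An oriented edge (side, j, m, up) of the tiling: if [side] holds, the edge
    number m of M_j counted from S, and otherwise the edge number m of the chord
    of the lune between M_(j-1) and M_j counted from its northern end.  The last
    component is the direction, northwards when true. *)
Definition oedge : Type := (bool * nat * nat * bool)%type.

(** Cyclic renumbering of the edges of the face k: from positions in its word to
    positions counted from its pole, and back in [reshift]. *)
Definition unshift k p :=
  if p < shift k then p + (face_len k./2 - shift k) else p - shift k.
Definition reshift k p :=
  if p < face_len k./2 - shift k then p + shift k else p - (face_len k./2 - shift k).

(** The oriented edge of the tiling along which the face k runs at position p,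
    counted from its pole: the opposite meridian, the chord, then the meridian
    M_(k./2). *)
Definition oedge_at k p : oedge :=
  let i := nbr k in let j := k./2 in
  if odd k then
    if p < d i then (true, i, p, true)
    else if p < d i + mid_len k then (false, i, mid_len k - 1 - (p - d i), true)
    else (true, j, a j - d j - 1 - (p - d i - mid_len k), false)
  else
    if p < d i then (true, i, a i - 1 - p, false)
    else if p < d i + mid_len k then (false, j, p - d i, false)
    else (true, j, p - d i - mid_len k + d j, true).

Definition oedge_valid (g : oedge) :=
  let: (side, j, m, _) := g in (j < n) && (m < if side then a j else mid_len j.*2).

Definition flip (g : oedge) : oedge := (g.1, ~~ g.2).

Definition oedge_label (g : oedge) : nat * bool :=
  let: (side, j, m, up) := g in
  if side then (j, up == d j)
  else ((j + n * A - 1 - d (pred_mod j) - m) %% n, up).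

(** The inverse of [oedge_at].  An edge of a meridian is run through northwards by
    an even face and southwards by an odd one, except where a chord has been
    folded onto it. *)
Definition face_of (g : oedge) : nat * nat :=
  let: (side, j, m, up) := g in
  if side then
    if up then
      if d j <= m then (j.*2, m + d (pred_mod j) + mid_len j.*2 - d j)
      else ((pred_mod j).*2.+1, m)
    else
      if m < a j - d j then (j.*2.+1, d (succ_mod j) + mid_len j.*2.+1 + (a j - d j - 1 - m))
      else ((succ_mod j).*2, a j - 1 - m)
  else
    if up then ((pred_mod j).*2.+1, d j + (mid_len j.*2 - 1 - m))
    else (j.*2, m + d (pred_mod j)).

Lemma nbr_even j : nbr j.*2 = pred_mod j. Proof. by rewrite /nbr odd_double doubleK. Qed.
Lemma nbr_odd j : nbr j.*2.+1 = succ_mod j.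
Proof. by rewrite /nbr /= odd_double uphalf_double. Qed.

Lemma half_odd j : j.*2.+1./2 = j. Proof. by rewrite /= uphalf_double. Qed.

Lemma mid_len_even j : mid_len j.*2 = n * A - d (pred_mod j) - d j.
Proof. by rewrite /mid_len nbr_even doubleK. Qed.
Lemma mid_len_odd j : mid_len j.*2.+1 = n * A - d (succ_mod j) - d j.
Proof. by rewrite /mid_len nbr_odd half_odd. Qed.

(** The chord has room for its folds: [d j] forces n >= 2, hence n A >= 4. *)
Lemma nA_ge i j : (d i + d j) + 2 <= n * A /\ 2 * d j + 2 <= n * A.
Proof.
have h k : d k -> 4 <= n * A by move/d_n; nia.
have : 2 <= n * A by nia.
have := h i; have := h j.
by case: (d i); case: (d j) => h1 h2 h3; try (have := h1 isT); try (have := h2 isT); lia.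
Qed.

Lemma mid_len_gt0 k : 0 < mid_len k.
Proof. by rewrite /mid_len; have [] := nA_ge (nbr k) k./2; lia. Qed.

Lemma face_lenE k : face_len k./2 = d (nbr k) + mid_len k + (a k./2 - d k./2).
Proof.
rewrite /mid_len /face_len; have [] := nA_ge (nbr k) k./2.
by have := a_ge2 k./2; have := leq_b1 (d k./2); lia.
Qed.

Lemma face_len_ge4 j : 4 <= face_len j.
Proof. by rewrite /face_len; have [] := nA_ge j j; have := a_ge2 j; lia. Qed.

Lemma shift_le k : shift k <= face_len k./2.
Proof. by rewrite /shift /face_len; have [] := nA_ge k./2 k./2; case: ifP; lia. Qed.

Lemma unshift_lt k p : p < face_len k./2 -> unshift k p < face_len k./2.
Proof. by move=> pL; rewrite /unshift; have := shift_le k; case: (ltnP p (shift k)); lia. Qed.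

Lemma reshift_lt k p : p < face_len k./2 -> reshift k p < face_len k./2.
Proof. by move=> pL; rewrite /reshift; have := shift_le k; case: (ltnP p (_ - _)); lia. Qed.

Lemma unshiftK k p : p < face_len k./2 -> reshift k (unshift k p) = p.
Proof.
move=> pL; rewrite /unshift /reshift; have := shift_le k => sh.
by case: (ltnP p (shift k)) => h; [case: (ltnP (p + _) _)|case: (ltnP (p - _) _)]; lia.
Qed.

Lemma reshiftK k p : p < face_len k./2 -> unshift k (reshift k p) = p.
Proof.
move=> pL; rewrite /unshift /reshift; have := shift_le k => sh.
by case: (ltnP p (_ - _)) => h; [case: (ltnP (p + _) _)|case: (ltnP (p - _) _)]; lia.
Qed.

Lemma double_or k : k = k./2.*2 \/ k = k./2.*2.+1.
Proof. by rewrite -{1 3}(odd_double_half k); case: odd; [right|left]. Qed.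

Lemma oedge_at_valid k p : k < n.*2 -> p < face_len k./2 -> oedge_valid (oedge_at k p).
Proof.
move=> kn; rewrite face_lenE; have jn : k./2 < n by lia.
move: kn jn; case: (double_or k) => ->; rewrite ?half_odd ?uphalf_double ?doubleK => kn jn;
  rewrite /oedge_at /= ?odd_double /= ?half_odd ?uphalf_double ?doubleK ?nbr_even ?nbr_odd
    ?mid_len_even ?mid_len_odd;
  have := a_ge2 k./2; have := a_ge2 (pred_mod k./2); have := a_ge2 (succ_mod k./2);
  move=> a1 a2 a3 pL.
  case: ltnP => h1 /=; first by rewrite pred_mod_lt; lia.
  by case: ltnP => h2 /=; rewrite ?mid_len_even ?jn /=; lia.
case: ltnP => h1 /=; first by rewrite succ_mod_lt; lia.
by case: ltnP => h2 /=; rewrite ?mid_len_even ?succ_mod_lt ?succ_modK ?jn //=; lia.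
Qed.

Lemma face_of_lt g : oedge_valid g ->
  (face_of g).1 < n.*2 /\ (face_of g).2 < face_len (face_of g).1./2.
Proof.
case: g => -[[side j] m] up /andP[jn]; have aj := a_ge2 j.
have sn := succ_mod_lt j; have pn := pred_mod_lt j.
have m1 := mid_len_gt0 j.*2; have m2 := mid_len_gt0 j.*2.+1.
rewrite face_lenE; case: side; case: up => mm; rewrite /face_of; [case: ifP => h|case: ifP => h| |];
  rewrite /= ?half_odd ?uphalf_double ?doubleK ?nbr_even ?nbr_odd ?pred_modK ?succ_modK //;
  rewrite ?mid_len_even ?mid_len_odd ?pred_modK ?succ_modK //;
  rewrite ?mid_len_even ?mid_len_odd in m1 m2 mm; split; lia.
Qed.

Lemma face_ofK g : oedge_valid g -> oedge_at (face_of g).1 (face_of g).2 = g.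
Proof.
case: g => -[[side j] m] up /andP[jn]; have aj := a_ge2 j.
have m1 := mid_len_gt0 j.*2; have m2 := mid_len_gt0 j.*2.+1.
case: side; case: up => mm; rewrite /face_of; [case: ifP => h|case: ifP => h| |];
  rewrite /oedge_at /= ?odd_double /= ?half_odd ?uphalf_double ?doubleK ?nbr_even ?nbr_odd
     ?pred_modK ?succ_modK //;
  rewrite ?mid_len_even ?mid_len_odd ?pred_modK ?succ_modK //;
  rewrite ?mid_len_even ?mid_len_odd in m1 m2 mm;
  repeat (case: ifP => ?); try lia; congr (_, _, _, _); lia.
Qed.

Lemma oedge_atK k p : k < n.*2 -> p < face_len k./2 -> face_of (oedge_at k p) = (k, p).
Proof.
move=> kn; rewrite face_lenE; have jn : k./2 < n by lia.
move: kn jn; case: (double_or k) => ->; rewrite ?half_odd ?uphalf_double ?doubleK => kn jn;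
  rewrite /oedge_at /= ?odd_double /= ?half_odd ?uphalf_double ?doubleK ?nbr_even ?nbr_odd
    ?mid_len_even ?mid_len_odd;
  have := a_ge2 k./2; have := a_ge2 (pred_mod k./2); have := a_ge2 (succ_mod k./2);
  move=> a1 a2 a3 pL.
  case: ifP => h1; [|case: ifP => h2]; rewrite /face_of;
    rewrite ?mid_len_even ?mid_len_odd ?pred_modK ?succ_modK //;
    repeat (case: ifP => ?); try lia; congr (_, _); lia.
case: ifP => h1; [|case: ifP => h2]; rewrite /face_of;
  rewrite ?mid_len_even ?mid_len_odd ?pred_modK ?succ_modK //;
  repeat (case: ifP => ?); try lia; congr (_, _); lia.
Qed.

Lemma mod_add_nA x : (x + n * A) %% n = x %% n.
Proof. by rewrite mulnC addnC modnMDl. Qed.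

Lemma letter_oedge_even j p : j < n -> p < face_len j ->
  letter_of j p = oedge_label (oedge_at j.*2 p).
Proof.
move=> jn; have := face_lenE j.*2.
rewrite doubleK /oedge_at /letter_of odd_double doubleK nbr_even mid_len_even => -> pL.
have [nA1 _] := nA_ge (pred_mod j) j.
case: ifP => h1; first case: ifP => h2.
- rewrite /oedge_label (_ : (false == _) = false); last by case: (d _) h2.
  congr (_, _); have := leq_b1 (d (pred_mod j)) => ?.
  rewrite /pred_mod -[RHS]mod_add_nA -[LHS]modnDr; congr (_ %% n); lia.
- by rewrite ifT /oedge_label; [congr (_ %% n, _); lia|lia].
- case: ifP => h2; first by lia.
  rewrite ifF; last by lia.
  by rewrite /oedge_label; case: (d j).
Qed.

Lemma letter_oedge_odd j p : j < n -> p < face_len j ->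
  linv (letter_of j (face_len j - 1 - reshift j.*2.+1 p)) =
  oedge_label (oedge_at j.*2.+1 p).
Proof.
move=> jn; have := face_lenE j.*2.+1.
rewrite half_odd mid_len_odd nbr_odd => LE.
have dj1 := leq_b1 (d j); have di1 := leq_b1 (d (succ_mod j)).
have [nA1 _] := nA_ge (succ_mod j) j; have aj := a_ge2 j; have [_ nA2] := nA_ge j j.
have shE : face_len j - shift j.*2.+1 = n * A - 1.
  by rewrite /shift /= odd_double uphalf_double /= /face_len; lia.
have shE2 : shift j.*2.+1 = 1 + a j - (d j + d j).
  by rewrite /shift /= odd_double uphalf_double /=.
rewrite /reshift half_odd shE shE2 /oedge_at nbr_odd half_odd mid_len_odd.
rewrite [odd _]/= odd_double [~~ _]/= /letter_of LE => pL.
clear LE shE shE2.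
set N := n * A in nA1 nA2 pL *; have LN : d (succ_mod j) + (N - d (succ_mod j) - d j) = N - d j by lia.
rewrite LN in pL *.
case: (ltnP p (d (succ_mod j))) => h1; last case: (ltnP p (N - d j)) => h2.
- have [di p0] : d (succ_mod j) /\ p = 0.
    move: h1; case: (d (succ_mod j)) => // h1; split=> //.
    by have : p < 1 := h1; rewrite ltnS leqn0 => /eqP.
  have p1 : p < N - 1 by lia.
  rewrite (ifT _ _ p1) ifT; last by lia.
  rewrite /linv /oedge_label di /=; congr (_, _); rewrite /succ_mod; congr (_ %% n).
  by lia.
- case: (boolP (p < N - 1)) => p1.
    rewrite ifT; last by lia.
    rewrite /linv /oedge_label /= succ_modK //; congr (_, _).
    transitivity ((j.+1 + p) %% n); first by congr (_ %% n); lia.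
    rewrite -modnDml -/(succ_mod j); congr (_ %% n); clear - nA1 nA2 h1 h2 p1 dj1 di1; lia.
  have dj : d j = false by apply/negbTE/negP => dj; move: h2; rewrite dj; lia.
  have pE : p = N - 1 by move: h2; rewrite dj; lia.
  rewrite ifF; last by rewrite dj; lia.
  rewrite /linv /oedge_label /= succ_modK // dj; congr (_, _).
  rewrite -[LHS](modn_small jn) -[LHS]mod_add_nA -/N.
  transitivity ((j.+1 + (N - 1)) %% n); first by congr (_ %% n); lia.
  rewrite -modnDml -/(succ_mod j); congr (_ %% n); clear - nA1 nA2 h1 h2 p1 dj1 di1; lia.
- have -> : (p < N - 1) = false by lia.
  rewrite /oedge_label; case: ifP => h3.
    have dj : d j = false.
      by apply/negbTE/negP => dj; move: h2 h3; rewrite dj; move: pL; rewrite dj; lia.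
    have pE : p = N + a j - 1 by move: pL h2 h3; rewrite dj; lia.
    rewrite /linv /= dj; congr (_, _); rewrite -[RHS](modn_small jn).
    congr (_ %% n); rewrite pE /= !subn0; clear - nA2 aj; lia.
  by rewrite /linv /=; case: (d j).
Qed.

(** The label of an oriented edge does not depend on the face from which it is
    read, except for its sign: this is what makes exchanging the two sides of
    every edge a syllable. *)
Lemma letter_oedge k p : k < n.*2 -> p < face_len k./2 ->
  letter k p = oedge_label (oedge_at k (unshift k p)).
Proof.
move=> kn pL; have jn : k./2 < n by lia.
case: (double_or k) => kE; last first.
  have rE := unshiftK pL; have uL := unshift_lt pL.
  rewrite kE half_odd in uL rE.
  rewrite -{1}rE kE /letter [odd _]/= odd_double half_odd [~~ _]/=.
  by apply: letter_oedge_odd.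
rewrite kE /letter odd_double doubleK -letter_oedge_even //.
  by rewrite /unshift /shift odd_double ltn0 subn0.
by rewrite /unshift /shift odd_double ltn0 subn0.
Qed.

End Pattern.

Local Open Scope classical_set_scope.
Local Open Scope ring_scope.

(** * Charts of the polygons *)

Section Heights.
Variables (R : realType) (a : nat -> nat) (d : nat -> bool).
Hypothesis a_ge2 : forall j, (2 <= a j)%N.

Definition side_step j : R := 2 / (a j)%:R.
(** The height at which chords meet M_j: [chord_height j] at the northern end
    of the chord of the lune after M_j, and its opposite at the southern end of
    the chord of the lune before M_j. *)
Definition chord_height j : R := 1 - side_step j * (d j)%:R.

Lemma side_step_gt0 j : 0 < side_step j.
Proof. by apply: divr_gt0 => //; rewrite ltr0n; have := a_ge2 j; lia. Qed.

Lemma side_step_a j : side_step j * (a j)%:R = 2.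
Proof. by rewrite /side_step divfK // pnatr_eq0; have := a_ge2 j; lia. Qed.

Lemma chord_height01 j : 0 <= chord_height j <= 1.
Proof.
have h0 := side_step_gt0 j; rewrite /chord_height; case: (d j) => /=; last by lra.
have : side_step j <= 1.
  by rewrite /side_step ler_pdivrMr ?ltr0n ?mul1r ?ler_nat //; have := a_ge2 j; lia.
lra.
Qed.

End Heights.

Section Reflection.
Variable R : realType.

Lemma opp_left (y : R) : (- (left_side y).1, - (left_side y).2) = right_side (- y).
Proof. by rewrite /left_side /right_side /= opprK sqrrN. Qed.

Lemma opp_right (y : R) : (- (right_side y).1, - (right_side y).2) = left_side (- y).
Proof. by rewrite /left_side /right_side /= sqrrN. Qed.

Lemma lune_gapN (p : R * R) : lune_gap (- p.1, - p.2) = lune_gap p.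
Proof. by rewrite /lune_gap /= sqrrN normrN. Qed.

End Reflection.

Section FaceMap.
Variable R : realType.
Variables (n A : nat) (a : nat -> nat) (d : nat -> bool).
Hypotheses (n_gt0 : (0 < n)%N) (A_ge2 : (2 <= A)%N) (a_ge2 : forall j, (2 <= a j)%N).
Hypothesis d_n : forall j, d j -> (1 < n)%N.

Local Notation nbr := (nbr n).
Local Notation mid_len := (mid_len n A d).
Local Notation face_len := (face_len n A a d).
Local Notation shift := (shift a d).
Local Notation unshift := (unshift n A a d).
Local Notation oedge_at := (oedge_at n A a d).
Local Notation pred_mod := (pred_mod n).
Local Notation succ_mod := (succ_mod n).
Local Notation side_step := (@side_step R a).
Local Notation chord_height := (@chord_height R a d).
Local Notation side_step_gt0 := (@side_step_gt0 R a a_ge2).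
Local Notation side_step_a := (@side_step_a R a a_ge2).
Local Notation chord_height01 := (@chord_height01 R a d a_ge2).

Definition oedge_lune (g : oedge) : nat :=
  let: (side, j, m, up) := g in if side && ~~ up then succ_mod j else j.

Definition oedge_pt (g : oedge) (t : R) : R * R :=
  let: (side, j, m, up) := g in
  if side then
    if up then right_side (-1 + side_step j * (m%:R + t))
    else left_side (-1 + side_step j * (m%:R + 1 - t))
  else chord (chord_height (pred_mod j)) (chord_height j)
         ((m%:R + (if up then 1 - t else t)) / (mid_len j.*2)%:R).

Definition face_lune (k : nat) : nat := if odd k then succ_mod k./2 else k./2.

(** Together with [lune_gap] this describes the face k: even faces lie above
    their chord and odd faces below it. *)
Definition face_side (k : nat) (p : R * R) : R :=
  let form := chord_form (chord_height (pred_mod (face_lune k)))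
    (chord_height (face_lune k)) p in
  if odd k then - form else form.

Lemma boundary_unshift k p (t : R) : (p < face_len k./2)%N ->
  boundary_pt (face_len k./2) (p%:R + t) =
  boundary_pt (face_len k./2) ((unshift k p)%:R + t + (shift k)%:R).
Proof.
move=> pL; rewrite /unshift; have sL := shift_le a n_gt0 A_ge2 d_n k.
case: ltnP => h; last by rewrite natrB //; congr boundary_pt; lra.
rewrite natrD natrB // -[LHS]boundary_ptD; last by lia.
by congr boundary_pt; lra.
Qed.

(** Even faces are given by [face_chart] and odd faces by its image under the
    half turn, which exchanges the roles of the two meridians. *)
Lemma face_map k : (k < n.*2)%N -> exists f : polygon R -> R * R,
  [/\ continuous f, injective f,
      forall p, (0 <= lune_gap p /\ 0 <= face_side k p) <-> exists x, f x = p &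
      forall p t, (p < face_len k./2)%N -> 0 <= t <= 1 ->
        f (boundary_pt (face_len k./2) (p%:R + t)) =
        oedge_pt (oedge_at k (unshift k p)) t].
Proof.
move=> kn; have jn : (k./2 < n)%N by lia.
have LE := face_lenE n_gt0 A_ge2 a_ge2 d_n k.
have l20 := mid_len_gt0 n_gt0 A_ge2 d_n k.
have := shift_le a n_gt0 A_ge2 d_n k; rewrite -(ler_nat R) => sL0.
have sL : (0 : R) <= (shift k)%:R <= ((face_len k./2)%:R : R).
  by apply/andP; split; [exact: ler0n|].
clear sL0.
move: (erefl (nbr k)) LE l20; move: {2 3}(nbr k) => i iE.
move: (erefl (mid_len k)); move: {2 3 4}(mid_len k) => l2 l2E.
move: (erefl k./2) jn sL; move: {-1}(k./2) => j jE jn sL LE l20.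
have dj1 := leq_b1 (d j); have aj := a_ge2 j.
have hi := side_step_gt0 i; have hj := side_step_gt0 j.
have hia := side_step_a i; have hja := side_step_a j.
have LR : (face_len j)%:R = (d i)%:R + l2%:R + ((a j)%:R - (d j)%:R) :> R.
  by rewrite LE !natrD natrB //; (clear - dj1 aj LE; lia).
have l20' : 0 < l2%:R :> R by rewrite ltr0n.
have l30 : 0 < (a j)%:R - (d j)%:R :> R by rewrite subr_gt0 ltr_nat; (clear - dj1 aj; lia).
have cE : 1 - side_step j * ((a j)%:R - (d j)%:R) = - chord_height j.
  by rewrite mulrBr hja /chord_height; lra.
have [f [cf injf imf [fl fc fr]]] := face_chart (chord_height01 i) (chord_height01 j)
  (ler0n _ (d i)) l20' l30 hi hj (erefl _) cE LR sL.
have di1 := leq_b1 (d i).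
pose f' := if odd k then (fun x => (- (f x).1, - (f x).2)) else f.
have f_edge p (t : R) : (p < face_len j)%N -> 0 <= t <= 1 ->
    f' (boundary_pt (face_len j) (p%:R + t + (shift k)%:R)) = oedge_pt (oedge_at k p) t.
  rewrite /oedge_at iE jE l2E => pL t01.
  have [p1|p1] := ltnP p (d i); last have [p2|p2] := ltnP p (d i + l2)%N.
  - have pR : p%:R + 1 <= (d i)%:R :> R by rewrite natr1 ler_nat.
    have p0 : 0 <= p%:R :> R by [].
    rewrite /f'; case: ifP => ok; (rewrite fl; last by lra).
      by rewrite opp_left /oedge_pt; congr right_side; lra.
    have := a_ge2 i => ai; have [q qE] : exists q, a i = (q + 1 + p)%N.
      by exists (a i - 1 - p)%N; (clear - ai p1 di1; lia).
    have qR : (a i)%:R = q%:R + 1 + p%:R :> R by rewrite qE !natrD.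
    rewrite /oedge_pt (_ : (a i - 1 - p)%N = q); last by (clear - qE; lia).
    by congr left_side; move: hia; rewrite qR; lra.
  - have [m pE] : exists m, p = (d i + m)%N by exists (p - d i)%N; (clear - p1; lia).
    have mR : m%:R + 1 <= l2%:R :> R by rewrite natr1 ler_nat; (clear - pE p2; lia).
    have m0 : 0 <= m%:R :> R by [].
    move: (iE); rewrite /f' /nbr jE; case: ifP => ok ijE;
      (rewrite fc; last by rewrite pE natrD; lra);
      rewrite pE natrD ?addKn.
      rewrite -chordN /oedge_pt -ijE succ_modK //.
      have mE : (mid_len (succ_mod j).*2 = l2)%N.
        by rewrite mid_len_even succ_modK // -l2E /mid_len iE jE -ijE; (clear - di1; lia).
      rewrite mE natrB; last by (clear - pE p2; lia).
      rewrite natrB //; congr (chord _ _ _); field.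
      by rewrite gt_eqF.
    have mE : (mid_len j.*2 = l2)%N by rewrite mid_len_even -l2E /mid_len iE jE -ijE.
    by rewrite /oedge_pt mE -ijE; congr (chord _ _ _); congr (_ / _); lra.
  - have [m pE] : exists m, p = (d i + l2 + m)%N by exists (p - (d i + l2))%N; (clear - p2; lia).
    have mL : (m + 1 + d j <= a j)%N by (clear - pE pL LE dj1 aj; lia).
    have mR : m%:R + 1 + (d j)%:R <= (a j)%:R :> R by rewrite natr1 -natrD ler_nat; (clear - mL; lia).
    have m0 : 0 <= m%:R :> R by [].
    rewrite /f'; case: ifP => ok; (rewrite fr; last by rewrite pE !natrD; lra);
      rewrite pE !natrD.
      rewrite opp_right /oedge_pt.
      rewrite (_ : (a j - d j - 1 - (d i + l2 + m - d i - l2) = a j - (d j + 1 + m))%N); last by (clear - mL; lia).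
      rewrite natrB; last by (clear - mL; lia).
      by rewrite !natrD; congr left_side; move: hja; lra.
    rewrite (_ : (d i + l2 + m - d i - l2 + d j = m + d j)%N); last by (clear - mL; lia).
    by rewrite /oedge_pt natrD; congr right_side; move: hja; lra.
exists f'; split.
- rewrite /f'; case: ifP => // _.
  by cont; exact: cf.
- rewrite /f'; case: ifP => // _ x y [/oppr_inj e1 /oppr_inj e2].
  by apply: injf; rewrite [f x]surjective_pairing e1 e2 -surjective_pairing.
- move=> p; rewrite /f' /face_side /face_lune jE.
  move: (iE); rewrite /nbr jE; case: ifP => ok ijE; last by rewrite ijE; exact: imf.
  rewrite succ_modK // ijE -lune_gapN -chord_formN; split.
    by case/imf => x fx; exists x; rewrite fx /= !opprK -surjective_pairing.
  by case=> x <-; apply/imf; exists x; rewrite /= !opprK -surjective_pairing.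
- move=> p t; rewrite -jE => pL t01; rewrite boundary_unshift // jE; apply: f_edge => //.
  rewrite -jE.
  exact: (unshift_lt n_gt0 A_ge2 d_n).
Qed.

End FaceMap.

(** * The polygons glue to a sphere *)

Section Gluing.
Variable R : realType.
Variables (n A : nat) (a : nat -> nat) (d : nat -> bool).
Hypotheses (n_gt0 : (0 < n)%N) (A_ge2 : (2 <= A)%N) (a_ge2 : forall j, (2 <= a j)%N).
Hypothesis d_n : forall j, d j -> (1 < n)%N.
Variables (T : eqType) (x_ : nat -> T) (N : nat) (bword : 'I_N -> seq (T * bool)).
Hypothesis N_eq : N = n.*2.

Local Notation nbr := (nbr n).
Local Notation mid_len := (mid_len n A d).
Local Notation face_len := (face_len n A a d).
Local Notation shift := (shift a d).
Local Notation unshift := (unshift n A a d).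
Local Notation reshift := (reshift n A a d).
Local Notation oedge_at := (oedge_at n A a d).
Local Notation face_of := (face_of n A a d).
Local Notation oedge_valid := (oedge_valid n A a d).
Local Notation oedge_label := (oedge_label n A d).
Local Notation letter := (letter n A a d).
Local Notation pred_mod := (pred_mod n).
Local Notation succ_mod := (succ_mod n).
Local Notation face_lune := (face_lune n).
Local Notation oedge_lune := (oedge_lune n).
Local Notation oedge_pt := (@oedge_pt R n A a d).
Local Notation face_side := (face_side n a d).
Local Notation side_step := (@side_step R a).
Local Notation chord_height := (@chord_height R a d).

Hypothesis bwordE : forall k : 'I_N,
  bword k = mkseq (fun p => (x_ (letter k p).1, (letter k p).2)) (face_len k./2).

Lemma size_bword k : size (bword k) = face_len k./2.
Proof. by rewrite bwordE size_mkseq. Qed.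

Lemma ord_lt (k : 'I_N) : (k < n.*2)%N.
Proof. by rewrite -N_eq. Qed.

Definition oedge_of (e : edge bword) : oedge := oedge_at (tag e) (unshift (tag e) (tagged e)).

Lemma edge_lt (e : edge bword) : (tagged e < face_len (tag e)./2)%N.
Proof. by rewrite -size_bword. Qed.

Lemma oedge_of_valid e : oedge_valid (oedge_of e).
Proof. by apply: oedge_at_valid; rewrite ?ord_lt ?unshift_lt ?edge_lt. Qed.

Lemma face_of_oedge e : face_of (oedge_of e) = (tag e : nat, unshift (tag e) (tagged e)).
Proof. by apply: oedge_atK; rewrite ?ord_lt ?unshift_lt ?edge_lt. Qed.

Lemma edge_eq (e e' : edge bword) :
  tag e = tag e' :> nat -> tagged e = tagged e' :> nat -> e = e'.
Proof.
case: e e' => [k p] [k' p'] /= /val_inj kk; case: k' / kk p' => p' /= /val_inj -> //.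
Qed.

Lemma edge_exists (k : 'I_N) p : (p < face_len k./2)%N ->
  exists e : edge bword, tag e = k :> nat /\ tagged e = p :> nat.
Proof.
rewrite -size_bword => pL.
by exists (existT (fun k => 'I_(size (bword k))) k (Ordinal pL)).
Qed.

Lemma oedge_of_inj : injective oedge_of.
Proof.
move=> e e' /(congr1 face_of); rewrite !face_of_oedge => -[kk /(congr1 (reshift (tag e)))].
rewrite unshiftK ?edge_lt // kk unshiftK ?edge_lt // => pp; exact: edge_eq.
Qed.

Lemma oedge_of_surj g : oedge_valid g -> exists e, oedge_of e = g.
Proof.
move=> gv; have [kn pL] := face_of_lt n_gt0 A_ge2 a_ge2 d_n gv.
have kN : ((face_of g).1 < N)%N by rewrite N_eq.
have [|e [ke pe]] := @edge_exists (Ordinal kN) (reshift (face_of g).1 (face_of g).2).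
  exact: reshift_lt.
exists e; rewrite /oedge_of ke pe /= reshiftK //; exact: face_ofK.
Qed.

Lemma flip_valid g : oedge_valid (flip g) = oedge_valid g.
Proof. by case: g => -[[]]. Qed.

Lemma flipK : involutive flip.
Proof. by move=> [g b]; rewrite /flip /= negbK. Qed.

Lemma mate_exists e : exists e', oedge_of e' = flip (oedge_of e).
Proof. by apply: oedge_of_surj; rewrite flip_valid oedge_of_valid. Qed.

Definition mate (e : edge bword) : edge bword := projT1 (cid (mate_exists e)).

Lemma oedge_of_mate e : oedge_of (mate e) = flip (oedge_of e).
Proof. by rewrite /mate; case: cid. Qed.

Lemma edge_labelE e : edge_label e = (x_ (oedge_label (oedge_of e)).1, (oedge_label (oedge_of e)).2).
Proof.
rewrite /oedge_of -(letter_oedge n_gt0 A_ge2 a_ge2 d_n) ?ord_lt ?edge_lt //.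
rewrite /edge_label (tnth_nth (x_ 0, true)) /=; have := edge_lt e.
by move: (nat_of_ord (tagged e)) => p pL; rewrite bwordE nth_mkseq.
Qed.

Lemma syllable_mate : syllable mate.
Proof.
split.
  by exists mate => e; apply: oedge_of_inj; rewrite !oedge_of_mate flipK.
move=> e; rewrite !edge_labelE oedge_of_mate; case: (oedge_of e) => -[[[] j] m] up //=.
by split => //; case: up; case: (d j).
Qed.

Lemma face_chart_exists (k : 'I_N) : exists f : polygon R -> R * R,
  [/\ continuous f, injective f,
      forall p, (0 <= lune_gap p /\ 0 <= face_side k p) <-> exists x, f x = p &
      forall p t, (p < face_len k./2)%N -> 0 <= t <= 1 ->
        f (boundary_pt (face_len k./2) (p%:R + t)) =
        oedge_pt (oedge_at k (unshift k p)) t].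
Proof. by apply: face_map; rewrite ?ord_lt. Qed.

Definition chart (k : 'I_N) : polygon R -> R * R := projT1 (cid (face_chart_exists k)).

Lemma continuous_chart k : continuous (chart k).
Proof. by rewrite /chart; case: cid => f []. Qed.
Lemma chart_inj k : injective (chart k).
Proof. by rewrite /chart; case: cid => f []. Qed.
Lemma chart_im (k : 'I_N) p : (0 <= lune_gap p /\ 0 <= face_side k p) <-> exists x, chart k x = p.
Proof. by rewrite /chart; case: cid => f []. Qed.
Lemma chart_edge (e : edge bword) (t : R) : 0 <= t <= 1 ->
  chart (tag e) (tagged (edge_pt e t)) = oedge_pt (oedge_of e) t.
Proof.
move=> t01; rewrite /chart; case: cid => f [_ _ _ fe] /=.
by have := fe _ t (edge_lt e) t01; rewrite -/(oedge_of e) => <-; rewrite -size_bword.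
Qed.

Lemma chart_gap k x : 0 <= lune_gap (chart k x).
Proof. by have [_ [|]] := chart_im k (chart k x); first by exists x. Qed.

Lemma face_lune_lt k : (k < n.*2)%N -> (face_lune k < n)%N.
Proof. by rewrite /face_lune; case: ifP => _ kn; [exact: succ_mod_lt|lia]. Qed.

Lemma oedge_lune_at k p : (k < n.*2)%N -> oedge_lune (oedge_at k p) = face_lune k.
Proof.
move=> kn; have jn : (k./2 < n)%N by lia.
rewrite /face_lune /oedge_at /nbr; case: (odd k).
  by case: (p < _)%N => //=; case: (p < _)%N.
by case: (p < _)%N => /=; [rewrite pred_modK|case: (p < _)%N].
Qed.

Lemma oedge_lune_of e : oedge_lune (oedge_of e) = face_lune (tag e).
Proof. by rewrite /oedge_of oedge_lune_at ?ord_lt. Qed.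

Definition develop (x : polygons R N) : R * R * R :=
  wrap n (face_lune (tag x)) (chart (tag x) (tagged x)).

Lemma develop_edge e (t : R) : 0 <= t <= 1 ->
  develop (edge_pt e t) = wrap n (oedge_lune (oedge_of e)) (oedge_pt (oedge_of e) t).
Proof. by move=> t01; rewrite /develop chart_edge // oedge_lune_of. Qed.

Lemma wrap_flip g (t : R) : oedge_valid g ->
  wrap n (oedge_lune g) (oedge_pt g t) =
  wrap n (oedge_lune (flip g)) (oedge_pt (flip g) (1 - t)).
Proof.
case: g => -[[[] j] m] [] /= /andP[jn _].
- by rewrite wrap_sides //; congr (wrap _ _ (left_side _)); ring.
- by rewrite [in RHS]wrap_sides //; congr (wrap _ _ (left_side _)); ring.
- by [].
- by rewrite subKr.
Qed.

Lemma develop_glue x y : edge_glue mate x y -> develop x = develop y.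
Proof.
case=> e [t [t01 -> ->]]; rewrite !develop_edge //; last first.
  by case/andP: t01 => t0 t1; apply/andP; split; lra.
by rewrite oedge_of_mate; apply: wrap_flip; exact: oedge_of_valid.
Qed.

(** Since charts are injective, a point of a polygon that is charted to a point
    of an edge of its boundary is the corresponding boundary point. *)
Lemma on_edge (x : polygons R N) g (t : R) : oedge_valid g -> 0 <= t <= 1 ->
  tag x = (face_of g).1 :> nat -> chart (tag x) (tagged x) = oedge_pt g t ->
  exists2 e, oedge_of e = g & x = edge_pt e t.
Proof.
move=> gv t01 kx xg; have [e eg] := oedge_of_surj gv; exists e => //.
have ke : tag x = tag e by apply: val_inj; rewrite /= kx -eg face_of_oedge.
move: xg; rewrite -eg -chart_edge //.
case: x ke {kx} => k p /= ke; rewrite /edge_pt /in_polygon.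
by move: (boundary_pt _ _) => q; rewrite -{}ke => /chart_inj ->.
Qed.

Lemma nat_frac (m : nat) (u : R) : (0 < m)%N -> 0 <= u <= m%:R ->
  exists q t, [/\ (q < m)%N, 0 <= t <= (1 : R) & u = q%:R + t].
Proof.
move=> m0 /andP[u0 um]; have [->|ne] := eqVneq u m%:R.
  exists m.-1, 1; rewrite prednK // ler01 lexx; split => //.
  by rewrite natr1 prednK.
have /andP[q1 q2] := truncn_itv u0.
exists (Num.truncn u), (u - (Num.truncn u)%:R); split; last by rewrite subrKC.
  by rewrite -(ltr_nat R); apply: le_lt_trans q1 _; rewrite lt_neqAle ne.
by rewrite -natr1 in q2; apply/andP; split; lra.
Qed.

Local Notation glue := (@glue_rel R T N bword mate).

Lemma glue_edge e (t : R) : 0 <= t <= 1 -> glue (edge_pt e t) (edge_pt (mate e) (1 - t)).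
Proof. by move=> t01; apply/asboolP; apply: rst_step; exists e, t. Qed.

Lemma glue_trans x y z : glue x y -> glue y z -> glue x z.
Proof. exact: glue_rel_trans. Qed.

Lemma glue_sym x y : glue x y -> glue y x.
Proof. by rewrite glue_rel_sym. Qed.

Lemma face_luneP (k : nat) j : (k < n.*2)%N -> face_lune k = j ->
  k = j.*2 \/ k = (pred_mod j).*2.+1.
Proof.
move=> kn; rewrite /face_lune; case: ifP => ok <-; [right|left].
  by rewrite succ_modK //; lia.
by lia.
Qed.

(** In one lune, points of the two different faces can only coincide on the
    chord, and the copies of an edge of the chord in the two faces are glued. *)
Lemma glue_same_lune (x y : polygons R N) : face_lune (tag x) = face_lune (tag y) ->
  chart (tag x) (tagged x) = chart (tag y) (tagged y) -> glue x y.
Proof.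
have [kxy _|kxy] := eqVneq (tag x) (tag y).
  case: x y kxy => [k p] [k' p'] /= kk; rewrite -{k'}kk in p' *.
  by move/chart_inj => ->; apply: glue_rel_refl.
move: kxy; wlog ox : x y / odd (tag x) = false.
  move=> wl ne ll cc; case ox : (odd (tag x)); last exact: wl.
  case oy : (odd (tag y)); last by apply: glue_sym; apply: wl => //; rewrite eq_sym.
  case: (face_luneP (ord_lt (tag x)) ll) => hx; first by rewrite hx odd_double in ox.
  case: (face_luneP (ord_lt (tag y)) (erefl _)) => hy; first by rewrite hy odd_double in oy.
  by case/eqP: ne; apply: val_inj; exact: etrans hx (esym hy).
move=> ne ll cc; set j := face_lune (tag x).
have jn : (j < n)%N by apply: face_lune_lt; exact: ord_lt.
have kx : tag x = j.*2 :> nat.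
  case: (face_luneP (ord_lt (tag x)) (erefl _)) => hx; first by rewrite /j -hx.
  by rewrite hx /= odd_double in ox.
have ky : tag y = (pred_mod j).*2.+1 :> nat.
  have [h|//] := face_luneP (ord_lt (tag y)) (esym ll).
  by case/eqP: ne; apply: val_inj; rewrite /= kx h.
have gap := chart_gap (tag x) (tagged x).
have [_ [|_ sx]] := chart_im (tag x) (chart (tag x) (tagged x)); first by exists (tagged x).
have [_ [|_ sy]] := chart_im (tag y) (chart (tag y) (tagged y)); first by exists (tagged y).
move: sx sy; rewrite -cc /face_side -ll -/j ox ky /= odd_double /= oppr_ge0 => sx sy.
have f0 : chord_form (chord_height (pred_mod j)) (chord_height j) (chart (tag x) (tagged x)) = 0.
  by apply/eqP; rewrite eq_le sx sy.
have [u u01 cu] := chord_surj (chord_height01 R d a_ge2 _) (chord_height01 R d a_ge2 _) gap f0.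
have l0 : (0 < mid_len j.*2)%N by exact: mid_len_gt0.
have l0' : 0 < (mid_len j.*2)%:R :> R by rewrite ltr0n.
have ul : 0 <= u * (mid_len j.*2)%:R <= (mid_len j.*2)%:R by apply/andP; split; nra.
have [q [t [ql t01 uE]]] := nat_frac l0 ul.
have gv : oedge_valid (false, j, q, false) by rewrite /= jn.
have [||e eg xe] := @on_edge x (false, j, q, false) t gv t01.
- by rewrite /= kx.
- by rewrite -cu /=; congr (chord _ _ _); rewrite -uE mulfK // gt_eqF.
have t01' : 0 <= 1 - t <= 1 by case/andP: t01 => t0 t1; apply/andP; split; lra.
have gv' : oedge_valid (false, j, q, true) by rewrite /= jn.
have [||e' eg' ye'] := @on_edge y (false, j, q, true) (1 - t) gv' t01'.
- by rewrite /= ky.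
- by rewrite -cc -cu /=; congr (chord _ _ _); rewrite subKr -uE mulfK // gt_eqF.
rewrite xe ye' (_ : e' = mate e); first exact: glue_edge.
by apply: oedge_of_inj; rewrite oedge_of_mate eg eg'.
Qed.

(** The two copies of each point of a meridian, in the lune before it and in the
    lune after it, are glued along the edge that contains it. *)
Lemma glue_sides j (y : R) : (j < n)%N -> -1 <= y <= 1 ->
  exists x x' : polygons R N, [/\ glue x x', face_lune (tag x) = j,
    face_lune (tag x') = succ_mod j,
    chart (tag x) (tagged x) = right_side y & chart (tag x') (tagged x') = left_side y].
Proof.
move=> jn y1; have aj : (0 < a j)%N by have := a_ge2 j; lia.
have h0 := side_step_gt0 R a_ge2 j; have ha := side_step_a R a_ge2 j.
have ul : 0 <= (y + 1) / side_step j <= (a j)%:R.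
  by rewrite divr_ge0 ?(ltW h0) ?ler_pdivrMr //=; lra.
have [q [t [ql t01 uE]]] := nat_frac aj ul.
have yE : side_step j * (q%:R + t) = y + 1 by rewrite -uE mulrC divfK // gt_eqF.
have t01' : 0 <= 1 - t <= 1 by case/andP: t01 => t0 t1; apply/andP; split; lra.
have [e eg] : exists e, oedge_of e = (true, j, q, true) by apply: oedge_of_surj; rewrite /= jn.
exists (edge_pt e t), (edge_pt (mate e) (1 - t)); split.
- exact: glue_edge.
- by rewrite -oedge_lune_of eg.
- by rewrite -oedge_lune_of oedge_of_mate eg.
- by rewrite chart_edge // eg /= yE; congr right_side; lra.
- rewrite chart_edge // oedge_of_mate eg /=; congr left_side.
  by rewrite (_ : q%:R + 1 - (1 - t) = q%:R + t) ?yE; [lra|ring].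
Qed.

Lemma side_pole (y : R) : y ^+ 2 = 1 -> right_side y = (0, y) /\ left_side y = (0, y).
Proof. by move=> y1; rewrite /right_side /left_side y1 subrr oppr0. Qed.

Lemma pole_range (y : R) : y ^+ 2 = 1 -> -1 <= y <= 1.
Proof. by move=> y1; apply/andP; split; nra. Qed.

(** All copies of a pole are identified by going around it from lune to lune,
    starting from the lune 0. *)
Lemma glue_pole (y : R) (x x' : polygons R N) : y ^+ 2 = 1 ->
  chart (tag x) (tagged x) = (0, y) -> chart (tag x') (tagged x') = (0, y) -> glue x x'.
Proof.
move=> y1; have [rE lE] := side_pole y1; have yr := pole_range y1.
have [z [_ [_ z0 _ zc _]]] := glue_sides n_gt0 yr; rewrite rE in zc.
suff from0 j (w : polygons R N) : (j < n)%N -> face_lune (tag w) = j ->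
    chart (tag w) (tagged w) = (0, y) -> glue z w.
  move=> xc xc'; apply: (@glue_trans _ z).
    by apply/glue_sym/(from0 (face_lune (tag x))) => //; apply: face_lune_lt; exact: ord_lt.
  by apply/(from0 (face_lune (tag x'))) => //; apply: face_lune_lt; exact: ord_lt.
elim: j w => [|j IH] w jn wl wc.
  by apply: glue_same_lune; rewrite ?z0 ?wl ?zc ?wc.
have jn' : (j < n)%N by lia.
have [v [v' [vv' vl vl' vc vc']]] := glue_sides jn' yr.
apply: (@glue_trans _ v); first by apply: IH; rewrite ?vc.
apply: (glue_trans vv'); apply: glue_same_lune; last by rewrite vc' wc.
by rewrite vl' wl /succ_mod modn_small.
Qed.

(** The fibres of [wrap] are matched one case at a time: same lune, meridian,
    pole. *)
Lemma develop_fib x y : develop x = develop y -> glue x y.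
Proof.
rewrite /develop => e.
have lx := face_lune_lt (ord_lt (tag x)); have ly := face_lune_lt (ord_lt (tag y)).
case: (wrap_fib lx ly (chart_gap _ _) (chart_gap _ _) e) =>
    [[jj cc]|[u [u1 cx cy jj]]|[u [u1 cy cx jj]]|[cx cy u1]].
- exact: glue_same_lune.
- have [z [z' [zz' zl zl' zc zc']]] := glue_sides lx u1.
  apply: (@glue_trans _ z); first by apply: glue_same_lune; rewrite ?zl ?zc ?cx.
  by apply: (glue_trans zz'); apply: glue_same_lune; rewrite ?zl' ?zc' ?cy.
- have [z [z' [zz' zl zl' zc zc']]] := glue_sides ly u1.
  apply: glue_sym; apply: (@glue_trans _ z); first by apply: glue_same_lune; rewrite ?zl ?zc ?cy.
  by apply: (glue_trans zz'); apply: glue_same_lune; rewrite ?zl' ?zc' ?cx.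
- by apply: (glue_pole u1); rewrite ?cy.
Qed.

Lemma develop_sphere x : sphere2 (develop x).
Proof. by apply: wrap_sphere; exact: chart_gap. Qed.

Definition develop_sub x : set_type (@sphere2 R) := SigSub (mem_set (develop_sphere x)).

Lemma chart_surj j p : (j < n)%N -> 0 <= lune_gap p ->
  exists x : polygons R N, face_lune (tag x) = j /\ chart (tag x) (tagged x) = p.
Proof.
move=> jn gap; have pn := pred_mod_lt n_gt0 j.
have k1 : (j.*2 < N)%N by rewrite N_eq; lia.
have k2 : ((pred_mod j).*2.+1 < N)%N by rewrite N_eq; lia.
have l1 : face_lune j.*2 = j by rewrite /face_lune odd_double doubleK.
have l2 : face_lune (pred_mod j).*2.+1 = j.
  by rewrite /face_lune [odd _]/= odd_double half_odd pred_modK.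
have [s0|s0] := leP 0 (chord_form (chord_height (pred_mod j)) (chord_height j) p).
  have [|x xp] := (chart_im (Ordinal k1) p).1.
    by split => //; rewrite /face_side l1 /= odd_double.
  by exists (in_polygon (Ordinal k1) x).
have [|x xp] := (chart_im (Ordinal k2) p).1.
  by split => //; rewrite /face_side l2 [odd _]/= odd_double oppr_ge0 ltW.
by exists (in_polygon (Ordinal k2) x).
Qed.

Lemma glued_sphere : homeomorphic (glued R mate) (set_type (@sphere2 R)).
Proof.
apply: (@glued_homeomorphic _ _ _ _ _ _ develop_sub).
- apply: continuous_set_type.
  have cwrap k : continuous (fun p : polygon R => wrap n (face_lune (k : 'I_N)) (chart k p)).
    by apply: continuous_after; [exact: continuous_wrap|exact: continuous_chart].
  rewrite (_ : (fun x => _) = unstable.sigT_fun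
    (fun (k : 'I_N) (p : polygon R) => wrap n (face_lune k) (chart k p))).
    exact: sigT_continuous cwrap.
  by apply/funext => -[k p].
- by apply: hausdorff_set_type; exact: (@norm_hausdorff R (R * R * R)%type).
- exact: compact_polygon.
- case=> q qs; have [j [p [jn gap pq]]] := wrap_surj n_gt0 (set_mem qs).
  have [x [xj xp]] := chart_surj jn gap.
  by exists x; apply: val_inj; rewrite /= /develop xj xp.
- by move=> x y xy; apply: val_inj; exact: develop_glue.
- by move=> x y /(congr1 val); exact: develop_fib.
Qed.


(** * Paths in the glued sphere *)

(** A closed face is embedded in the sphere.  The only danger is a face that
    touches both sides of its lune when these are the same meridian, that is
    when n = 1; then nothing is folded, the chord joins the two poles, and the
    face meets one of the sides at the poles only. *)
Lemma to_glued_face_inj k (p p' : polygon R) :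
  to_glued mate (in_polygon k p) = to_glued mate (in_polygon k p') -> p = p'.
Proof.
move/to_gluedE/(glue_rel_invariant develop_glue); rewrite /develop /=.
have kn := face_lune_lt (ord_lt k) => e.
have pole (u : R) : face_lune k = ((face_lune k).+1 %% n)%N -> -1 <= u <= 1 ->
    0 <= face_side k (left_side u) -> 0 <= face_side k (right_side u) ->
    left_side u = right_side u.
  move=> kk u1.
  have n1 : n = 1%N.
    move: kn kk; rewrite leq_eqVlt => /predU1P[nE|kn kk].
      by rewrite nE modnn => k0; rewrite -nE k0.
    by move: kk; rewrite modn_small // => /eqP; rewrite eqn_leq ltnn andbF.
  have c1 j : chord_height j = 1.
    rewrite /chord_height; case dj : (d j) => /=; last by rewrite mulr0 subr0.
    by have := d_n dj; rewrite n1.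
  rewrite /face_side !c1 chord_form_left chord_form_right => s1 s2.
  have u2 : u ^+ 2 = 1.
    have le : u ^+ 2 <= 1 by case/andP: u1 => ? ?; nra.
    by apply/eqP; rewrite eq_le le /=; move: s1 s2; case: ifP => _; lra.
  by have [-> ->] := side_pole u2.
have side q : 0 <= face_side k (chart k q).
  by have [_ [|_]] := chart_im k (chart k q); first by exists q.
apply: (@chart_inj k).
case: (wrap_fib kn kn (chart_gap _ _) (chart_gap _ _) e) =>
    [[_ //]|[u [u1 cx cy jj]]|[u [u1 cy cx jj]]|[_ cy _]].
- by rewrite cx cy; apply/esym/pole => //; rewrite -?cx -?cy.
- by rewrite cx cy; apply/pole => //; rewrite -?cx -?cy.
- by rewrite cy.
Qed.

Lemma edge_pt_inj (e : edge bword) (t t' : R) : 0 <= t <= 1 -> 0 <= t' <= 1 ->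
  to_glued mate (edge_pt e t) = to_glued mate (edge_pt e t') -> t = t'.
Proof.
move=> t01 t01' /to_glued_face_inj.
have L4 := face_len_ge4 n_gt0 A_ge2 a_ge2 d_n (tag e)./2.
have eL := edge_lt e.
move: (nat_of_ord (tagged e)) eL => p pL; rewrite size_bword.
have pR : p%:R + 1 <= (face_len (tag e)./2)%:R :> R by rewrite natr1 ler_nat.
have p0 : 0 <= p%:R :> R by [].
have L2 : 4 <= (face_len (tag e)./2)%:R :> R by rewrite ler_nat.
have cl (u : R) : 0 <= u <= 1 -> 0 <= p%:R + u <= (face_len (tag e)./2)%:R.
  by move=> /andP[u0 u1]; apply/andP; split; lra.
case/(boundary_pt_inj _ (cl _ t01) (cl _ t01')); first by apply: leq_trans L4.
  exact: addrI.
rewrite (_ : p%:R + t - (p%:R + t') = t - t'); last by ring.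
have : `|t - t'| <= 1 by rewrite ler_norml; apply/andP; split; lra.
lra.
Qed.

Lemma continuous_to_glued : continuous (to_glued mate : polygons R N -> glued R mate).
Proof. exact: (@pi_continuous _ (glued_quot R mate)). Qed.

Lemma continuous_in_polygon k (f : R -> polygon R) : continuous f ->
  continuous (fun t => in_polygon k (f t) : polygons R N).
Proof.
by move=> cf t; apply: (@continuous_comp _ _ _ f (in_polygon k));
  [exact: cf|exact: existT_continuous].
Qed.

Lemma continuous_edge_pt (e : edge bword) : continuous (fun t : R => to_glued mate (edge_pt e t)).
Proof.
have cb : continuous (fun t : R => boundary_pt (size (bword (tag e))) ((tagged e)%:R + t)).
  apply: (@continuous_after _ _ _ (boundary_pt _) (fun t : R => (tagged e)%:R + t)).
    exact: continuous_boundary_pt.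
  by cont.
exact: (continuous_after continuous_to_glued (@continuous_in_polygon (tag e) _ cb)).
Qed.

Lemma glued_boundary_pt k l (t : R) :
  @glued_boundary R T N bword mate k (to_glued mate (in_polygon k (boundary_pt l t))).
Proof. by exists (boundary_pt l t) => //=; rewrite cos2Dsin2. Qed.

Definition face_path (k : 'I_N) (t : R) : glued R mate :=
  to_glued mate (in_polygon k (boundary_pt (size (bword k)) t)).

Lemma boundary_path_face k : boundary_path k (face_path k).
Proof.
have L4 := face_len_ge4 n_gt0 A_ge2 a_ge2 d_n k./2.
have l0 : (0 < size (bword k))%N by rewrite size_bword; apply: leq_trans L4.
split.
- apply: continuous_subspaceT.
  exact: (continuous_after continuous_to_glued
           (@continuous_in_polygon k _ (@continuous_boundary_pt R _))).
- move=> t t'; rewrite !in_itv /= => /andP[t0 tl] /andP[t0' tl'] /to_glued_face_inj.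
  case/boundary_pt_inj => //; try by apply/andP; split => //; exact: ltW.
  have : `|t - t'| < (size (bword k))%:R by rewrite ltr_norml; apply/andP; split; lra.
  by move=> /[swap] ->; rewrite ltxx.
- by move=> t _; exact: glued_boundary_pt.
- move=> j; exists (fun t => t - j%:R); split => //=.
  + by apply: continuous_subspaceT; cont.
  + by move=> t t' _ _; rewrite ltrD2r.
  + by rewrite subrr.
  + by rewrite addrC addKr.
  + by move=> t _; rewrite /face_path /edge_pt /= subrKC.
Qed.

Lemma face_path_closed k : face_path k 0 = face_path k (size (bword k))%:R.
Proof.
have L4 := face_len_ge4 n_gt0 A_ge2 a_ge2 d_n k./2.
have l0 : (0 < size (bword k))%N by rewrite size_bword; apply: leq_trans L4.
by rewrite /face_path -[in RHS](add0r (size _)%:R) boundary_ptD.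
Qed.

Lemma conjugator_path_nil (z : glued R mate) :
  (exists k, @glued_boundary R T N bword mate k z) -> conjugator_path [::] (fun=> z).
Proof.
move=> zb; split => //=.
- by apply: continuous_subspaceT => ?; exact: cvg_cst.
- move=> t t'; rewrite !in_itv /= => /andP[t0 t1] /andP[t0' t1'] _.
  by apply/eqP; rewrite eq_le; apply/andP; split; [apply: le_trans t1 _|apply: le_trans t1' _].
- by case.
Qed.

Lemma conjugator_path_edge (e : edge bword) :
  conjugator_path [:: linv (edge_label e)]
    (fun t : R => to_glued mate (edge_pt e (1 - t))).
Proof.
have flip01 (t : R) : 0 <= t <= 1 -> 0 <= 1 - t <= 1.
  by move=> /andP[t0 t1]; apply/andP; split; lra.
split => /=.
- apply: continuous_subspaceT.
  by apply: (continuous_after (@continuous_edge_pt e)); cont.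
- move=> t t'; rewrite !in_itv /= => t1 t1' /edge_pt_inj h.
  by have := h (flip01 _ t1) (flip01 _ t1'); lra.
- by move=> t _; exists (tag e); exact: glued_boundary_pt.
- case=> -[|//] i0; exists e; split => //=.
  rewrite (_ : (_ == _) = false); last first.
    by rewrite /=; case: (edge_label e).2.
  exists (fun t => t); split => //.
  + by apply: continuous_subspaceT; cont.
  + by rewrite add0r.
Qed.

Definition conj_word (k : nat) : seq (T * bool) :=
  if odd k then [:: (x_ k./2, false)] else [::].

(** The conjugating path of an odd face traverses backwards an edge labelled x_j
    that starts at the base vertex of the face.  Without folding this is the
    first edge of its own word.  With folding that edge has been cancelled, and
    the last edge of M_j, seen from the lune before M_j, takes its place. *)
Lemma base_edge (k : 'I_N) : odd k -> exists e : edge bword,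
  edge_label e = (x_ k./2, true) /\ to_glued mate (edge_pt e 0) = face_path k 0.
Proof.
move=> ok; set j := k./2; have kn := ord_lt k; have jn : (j < n)%N by rewrite /j; lia.
have L4 := face_len_ge4 n_gt0 A_ge2 a_ge2 d_n j.
have pL : (0 < size (bword k))%N by rewrite size_bword; apply: leq_trans L4.
pose e0 : edge bword := existT (fun k => 'I_(size (bword k))) k (Ordinal pL).
have e0E : to_glued mate (edge_pt e0 0) = face_path k 0.
  by rewrite /face_path /edge_pt /= add0r.
case dj : (d j); last first.
  exists e0; split => //; rewrite /edge_label (tnth_nth (x_ 0, true)) /= bwordE.
  rewrite nth_mkseq; last by rewrite -/j; apply: leq_trans L4.
  have aj := a_ge2 j; have [nA _] := nA_ge n_gt0 A_ge2 d_n j j.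
  rewrite /letter ok /letter_of -/j ifF; last by rewrite /face_len dj; clear - aj nA; lia.
  by rewrite /linv dj.
have [e eE] : exists e, oedge_of e = (true, j, (a j - 1)%N, true).
  by apply: oedge_of_surj; rewrite /= jn; have := a_ge2 j; lia.
exists e; split; first by rewrite edge_labelE eE /= dj.
rewrite -e0E; apply/to_gluedE/develop_fib.
have z01 : 0 <= (0 : R) <= 1 by rewrite lexx ler01.
rewrite !develop_edge // eE.
have -> : oedge_of e0 = (true, j, (a j - 2)%N, false).
  have aj := a_ge2 j; have [nA _] := nA_ge n_gt0 A_ge2 d_n j (nbr k).
  have nA2 : (4 <= n * A)%N by have := d_n dj; nia.
  rewrite /oedge_of /= /unshift /shift ok -/j dj ifT; last by clear - aj; lia.
  rewrite /oedge_at ok -/j /mid_len dj.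
  have db := leq_b1 (d (nbr k)).
  rewrite ifF; last by rewrite /face_len dj; clear - aj nA nA2 db; lia.
  rewrite ifF; last by rewrite /face_len dj; clear - aj nA nA2 db; lia.
  congr (_, _, _, _); rewrite /face_len dj; clear - aj nA nA2 db; lia.
rewrite /= -wrap_sides //; congr (wrap _ _ (right_side _)).
have [q qE] : exists q, a j = (q + 2)%N by exists (a j - 2)%N; have := a_ge2 j; lia.
by rewrite qE addnK (_ : (q + 2 - 1 = q.+1)%N) ?natr1 ?subr0 ?addr0 //; clear; lia.
Qed.

Theorem gluing_taut : exists I : edge bword -> edge bword,
  [/\ syllable I,
      homeomorphic (glued R I) (set_type (@sphere2 R)) &
      exists kappa lambda : 'I_N -> R -> glued R I, forall k : 'I_N,
        [/\ conjugator_path (conj_word k) (kappa k),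
            boundary_path k (lambda k),
            kappa k (size (conj_word k))%:R = lambda k 0 &
            lambda k 0 = lambda k (size (bword k))%:R]].
Proof.
exists mate; split; [exact: syllable_mate|exact: glued_sphere|].
have kex (k : 'I_N) : exists kap, conjugator_path (conj_word k) kap /\
    kap (size (conj_word k))%:R = face_path k 0.
  rewrite /conj_word; case: ifP => [ok|_]; last first.
    exists (fun=> face_path k 0); split => //; apply: conjugator_path_nil.
    by exists k; exact: glued_boundary_pt.
  have [e [el e0]] := base_edge ok.
  exists (fun t : R => to_glued mate (edge_pt e (1 - t))); split; last by rewrite /= subrr.
  by have := conjugator_path_edge e; rewrite el.
have [kap kapP] := choice kex.
exists kap, face_path => k; have [kp ke] := kapP k; split => //.
- exact: boundary_path_face.
- exact: face_path_closed.
Qed.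

End Gluing.

Close Scope ring_scope.

(** * Relator words *)

Section Words.
Variable T : choiceType.
Implicit Types (w : seq (T * bool)) (x : T).

(** The element of the free group represented by a word, reduced or not. *)
Definition wprod w : free_group T := (\prod_(c <- w) signed (fgen c.1) c.2)%g.

Lemma fword_signed (c : T * bool) : fword (signed (fgen c.1) c.2) = [:: c].
Proof. by case: c => x []. Qed.

Lemma fword_wprod w : reduced w -> fword (wprod w) = w.
Proof.
move=> rw; rewrite -[RHS](reduce_onto0 rw).
elim: w {rw} => [|c w IH] /=; first by rewrite /wprod big_nil.
by rewrite /wprod big_cons [LHS]/= fword_signed /= -IH.
Qed.

Lemma wprod_cat v w : wprod (v ++ w) = (wprod v * wprod w)%g.
Proof. by rewrite /wprod big_cat. Qed.

Lemma wprod_winv w : wprod (winv w) = (wprod w)^-1%g.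
Proof.
elim: w => [|c w IH]; first by rewrite /wprod !big_nil invg1.
rewrite /winv /= rev_cons -cats1 wprod_cat -/(winv w) IH.
rewrite /wprod big_seq1 big_cons invgM; congr (_ * _)%g.
by case: c => x [] //=; rewrite invgK.
Qed.

Lemma wprod_nseq m (c : T * bool) : wprod (nseq m c) = (signed (fgen c.1) c.2 ^+ m)%g.
Proof.
elim: m => [|m IH]; first by rewrite /wprod big_nil expg0.
by rewrite /wprod big_cons -/(wprod _) IH expgS.
Qed.

Lemma flift_gen (G : groupType) (f : T -> G) x : flift f (fgen x) = f x.
Proof. by rewrite /flift big_seq1. Qed.

End Words.

Lemma zexpgN (G : groupType) (g : G) (k : nat) : zexpg g (- k%:Z)%R = (g ^- k)%g.
Proof. by case: k => [|k] /=; rewrite ?expg0 ?invg1. Qed.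

Lemma mkseqD (T : Type) (f : nat -> T) m k :
  mkseq f (m + k) = mkseq f m ++ mkseq (fun p => f (m + p)) k.
Proof.
rewrite /mkseq iotaD map_cat; congr (_ ++ _).
by rewrite add0n -{1}[m]addn0 iotaDl -map_comp.
Qed.

Lemma winv_mkseq (T : choiceType) (f : nat -> T * bool) m :
  winv (mkseq f m) = mkseq (fun p => linv (f (m - 1 - p))) m.
Proof.
case: m => [//|m].
apply: (@eq_from_nth _ (linv (f 0))); first by rewrite /winv size_rev size_map !size_mkseq.
rewrite /winv size_rev size_map size_mkseq => i im.
rewrite nth_rev ?size_map ?size_iota // (nth_map (f 0)) ?size_mkseq; last by lia.
by rewrite !nth_mkseq ?subSS ?subn0 //; lia.
Qed.

Lemma nth_pairs (S U : Type) (s0 : S) (u0 : U) (f g : S -> U) (s : seq S) k :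
  (k < (size s).*2)%N ->
  nth u0 (flatten [seq [:: f i; g i] | i <- s]) k =
  (if odd k then g else f) (nth s0 s k./2).
Proof.
elim: s k => [|x s IH] [|[|k]] //= ks.
by rewrite negbK IH.
Qed.

Section Generators.
Variable n' : nat.
Local Notation n := n'.+1.

(** Generators are indexed by natural numbers so that indices can be computed
    modulo n. *)
Definition gen_ord (j : nat) : 'I_n := inord j.
Lemma gen_ordK (i : 'I_n) : gen_ord i = i.
Proof. exact: inord_val. Qed.

(** The product P_i; the index may exceed n. *)
Definition cycle_prod (i : nat) : free_group 'I_n :=
  (\prod_(0 <= k < n) fgen (gen_ord ((i + k) %% n)%N))%g.

Lemma cycle_prod_rot (i : 'I_n) : (\prod_(j <- rot i (enum 'I_n)) fgen j)%g = cycle_prod i.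
Proof.
have -> : rot i (enum 'I_n) = [seq gen_ord ((i + k) %% n) | k <- index_iota 0 n].
  apply: (@eq_from_nth _ ord0).
    by rewrite size_rot size_enum_ord size_map size_iota subn0.
  rewrite size_rot size_enum_ord => k kn.
  rewrite (nth_map 0) ?size_iota ?subn0 // nth_iota ?subn0 // add0n.
  have nthE j : (j < n)%N -> nth ord0 (enum 'I_n) j = gen_ord j.
    by move=> jn; apply: val_inj; rewrite /= nth_enum_ord // inordK.
  have iN := ltn_ord i.
  rewrite /rot nth_cat size_drop size_enum_ord; case: ltnP => h.
    by rewrite nth_drop nthE ?modn_small //; lia.
  rewrite nth_take; last by lia.
  rewrite nthE; last by lia.
  congr gen_ord; rewrite (_ : i + k = k - (n - i) + n); last by lia.
  by rewrite modnDr modn_small //; lia.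
by rewrite big_map.
Qed.

Lemma cycle_prodX i m : (cycle_prod i ^+ m)%g =
  wprod (mkseq (fun p => (gen_ord ((i + p) %% n), true)) (n * m)).
Proof.
elim: m => [|m IH]; first by rewrite muln0 /wprod big_nil.
rewrite expgS mulnS mkseqD wprod_cat; congr (_ * _)%g.
  by rewrite /wprod /mkseq big_map /cycle_prod /index_iota subn0.
rewrite IH; congr (wprod _); apply: eq_mkseq => p.
by rewrite addnCA modnDl.
Qed.

Lemma cycle_prodXV i m : (cycle_prod i ^- m)%g =
  wprod (mkseq (fun p => (gen_ord ((i + n * m - 1 - p) %% n), false)) (n * m)).
Proof.
rewrite cycle_prodX -wprod_winv winv_mkseq; congr (wprod _).
apply: (@eq_from_nth _ (ord0, true)); first by rewrite !size_mkseq.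
rewrite size_mkseq => p pA; rewrite !nth_mkseq // /linv /=.
by congr (gen_ord (_ %% n), _); lia.
Qed.

(** Conjugation by x_i turns P_i into P_(i+1): both sides are the product of
    n + 1 consecutive generators starting at x_i. *)
Lemma cycle_prodS i : (cycle_prod i * fgen (gen_ord (i %% n)%N))%g =
  (fgen (gen_ord (i %% n)%N) * cycle_prod i.+1)%g.
Proof.
transitivity (\prod_(0 <= k < n.+1) fgen (gen_ord ((i + k) %% n)%N))%g.
  by rewrite [RHS]big_nat_recr //= modnDr.
rewrite big_nat_recl //= addn0; congr (_ * _)%g.
by apply: eq_bigr => k _; rewrite addSnnS.
Qed.

Lemma size_W_factors : size (W_factors n) = n.*2.
Proof.
rewrite /W_factors -[in RHS](size_enum_ord n).
by elim: (enum _) => //= x s ->.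
Qed.

Lemma tnth_W_factors (k : 'I_(size (W_factors n))) :
  tnth (in_tuple (W_factors n)) k =
  if odd k then Factor (fgen (gen_ord k./2))^-1%g (gen_ord k./2) false
  else Factor 1%g (gen_ord k./2) true.
Proof.
have kn : (k < n.*2)%N by rewrite -size_W_factors.
rewrite (tnth_nth (Factor 1%g ord0 true)) /W_factors (nth_pairs ord0) ?size_enum_ord //.
have -> : nth ord0 (enum 'I_n) k./2 = gen_ord k./2.
  by apply: val_inj; rewrite /= nth_enum_ord ?inordK //; lia.
by case: ifP.
Qed.

Lemma fword_fconj (k : 'I_(size (W_factors n))) :
  fword (fconj (tnth (in_tuple (W_factors n)) k)) =
  if odd k then [:: (gen_ord k./2, false)] else [::].
Proof. by rewrite tnth_W_factors; case: ifP. Qed.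

Lemma W_factors_val : W n = factors_val (W_factors n).
Proof.
rewrite /factors_val /W_factors big_flatten big_map.
rewrite /W [index_enum _]unlock -enumT; apply: eq_bigr => i _; rewrite big_cons big_seq1.
rewrite /factor_val [fconj _]/= [fidx _]/= [fsign _]/=.
have F1 : F_to_PF (1%g : free_group 'I_n) = 1%g by rewrite /F_to_PF gmulf1.
have F2 : F_to_PF (fgen i)^-1%g = (xPF i)^-1%g.
  by rewrite /F_to_PF gmulfV; congr (_^-1)%g; exact: flift_gen.
by rewrite F1 F2 mul1g invg1 mulg1 invgK -mulgA.
Qed.

End Generators.

Section Relators.
Variable n' : nat.
Local Notation n := n'.+1.
Variables (a : 'I_n.+1 -> nat) (eps : 'I_n -> int).
Local Notation gen_ord := (gen_ord n').
Hypothesis a_ge2 : forall i, (2 <= a i)%N.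
Hypothesis eps_pm1 : forall i, eps i = 1%R \/ eps i = (-1)%R.
Hypothesis eps_one : n = 1 -> forall i, eps i = (-1)%R.

Definition last_exp : nat := a ord_max.
Definition gen_exp (j : nat) : nat := a (emb (gen_ord j)).
Definition gen_pos (j : nat) : bool := eps (gen_ord j) == 1%R.

Local Notation A := last_exp.
Local Notation letter_of := (letter_of n A gen_pos).
Local Notation letter := (letter n A gen_exp gen_pos).
Local Notation face_len := (face_len n A gen_exp gen_pos).
Local Notation cycle_prod := (cycle_prod n').
Local Notation named c := (gen_ord c.1, c.2).

Lemma last_exp_ge2 : (2 <= A)%N. Proof. exact: a_ge2. Qed.
Lemma gen_exp_ge2 j : (2 <= gen_exp j)%N. Proof. exact: a_ge2. Qed.

Lemma gen_pos_lt j : gen_pos j -> (1 < n)%N.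
Proof.
rewrite /gen_pos => /eqP e; case n1 : n' => [|//].
by have := eps_one (congr1 S n1) (gen_ord j); rewrite e.
Qed.

Lemma rel_rE (i : 'I_n) : rel_r a eps i =
  (cycle_prod i ^- A * signed (fgen i) (gen_pos i) ^+ gen_exp i)%g.
Proof.
rewrite /rel_r cycle_prod_rot zexpgN; congr (_ * _)%g.
rewrite /gen_pos /gen_exp gen_ordK; have [-> | ->] := eps_pm1 i.
  by rewrite GRing.mul1r.
by rewrite GRing.mulN1r zexpgN /= expVgn.
Qed.

Lemma mkseq_letter_of j : mkseq (fun p => named (letter_of j p)) (face_len j) =
  mkseq (fun p => (gen_ord ((j + n * A - 1 - p) %% n), false)) (n * A - gen_pos j) ++
  nseq (gen_exp j - gen_pos j) (gen_ord j, gen_pos j).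
Proof.
have [_ nA] := nA_ge (ltn0Sn n') last_exp_ge2 gen_pos_lt j j.
have aj := gen_exp_ge2 j; have d1 := leq_b1 (gen_pos j).
rewrite (_ : face_len j = n * A - gen_pos j + (gen_exp j - gen_pos j)); last first.
  by rewrite /face_len; lia.
rewrite mkseqD; congr (_ ++ _).
  apply: (@eq_from_nth _ (ord0, true)); first by rewrite !size_mkseq.
  by rewrite size_mkseq => p pL; rewrite !nth_mkseq // /letter_of pL.
apply: (@eq_from_nth _ (ord0, true)); first by rewrite size_mkseq size_nseq.
rewrite size_mkseq => p pL; rewrite nth_mkseq // nth_nseq pL /letter_of ifF //.
by lia.
Qed.

(** At most one cancellation occurs, between the last letter x_i^-1 of P_i^-A
    and the first letter of x_i^(a_i). *)
Lemma rel_r_wprod (i : 'I_n) :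
  rel_r a eps i = wprod (mkseq (fun p => named (letter_of i p)) (face_len i)).
Proof.
rewrite mkseq_letter_of wprod_cat wprod_nseq rel_rE cycle_prodXV gen_ordK /=.
have nA : (1 < n * A)%N by have := last_exp_ge2; lia.
case: (gen_pos i); last by rewrite !subn0.
have -> : n * A = (n * A - 1) + 1 by lia.
rewrite mkseqD wprod_cat addnK -mulgA; congr (_ * _)%g.
have [q ->] : exists q, gen_exp i = q.+1.
  by exists (gen_exp i - 1); have := gen_exp_ge2 i; lia.
have -> : q.+1 - true = q by rewrite subSS subn0.
rewrite expgS mulgA -[RHS]mul1g; congr (_ * _)%g.
rewrite /wprod /mkseq /= big_seq1 /=.
rewrite (_ : gen_ord _ = i) ?mulVg // -[RHS]gen_ordK; congr gen_ord.
rewrite -[RHS](modn_small (ltn_ord i)); congr (_ %% n); lia.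
Qed.

Lemma reduced_letters (i : 'I_n) :
  reduced (mkseq (fun p => named (letter_of i p)) (face_len i)).
Proof.
apply/(sortedP (ord0, true)); rewrite size_mkseq => p pL.
rewrite !nth_mkseq //; last by apply: ltnW.
rewrite /letter_of /linv; case: ifP => h1; case: ifP => h2 //=.
- by rewrite xpair_eqE andbF.
- by lia.
- case d1 : (gen_pos i); last by rewrite xpair_eqE andbF.
  have n1 := gen_pos_lt d1.
  have nA : (2 <= n * A)%N by have := last_exp_ge2; lia.
  have pE : p = (n * A - 2)%N by move: h1 h2; rewrite d1; lia.
  rewrite xpair_eqE eqxx andbT -val_eqE /= !inordK ?ltn_ord ?ltn_pmod //.
  rewrite pE (_ : i + n * A - 1 - (n * A - 2) = i.+1); last by lia.
  have iN := ltn_ord i; move: (iN); rewrite leq_eqVlt => /predU1P[iE|lt].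
    by rewrite [in X in _ != X %% _]iE modnn; lia.
  by rewrite modn_small //; lia.
- by rewrite xpair_eqE negb_and; case: (gen_pos i); rewrite orbT.
Qed.

Lemma fword_rel_r (i : 'I_n) :
  fword (rel_r a eps i) = mkseq (fun p => named (letter_of i p)) (face_len i).
Proof. by rewrite rel_r_wprod fword_wprod // reduced_letters. Qed.

Lemma fword_factor_rel (k : 'I_(size (W_factors n))) :
  fword (factor_rel (rel_r a eps) (tnth (in_tuple (W_factors n)) k)) =
  mkseq (fun p => named (letter k p)) (face_len k./2).
Proof.
have kn : (k < n.*2)%N by rewrite -size_W_factors.
have kE : val (gen_ord k./2) = k./2 by rewrite /= inordK //; lia.
rewrite tnth_W_factors /factor_rel /letter; case: (odd k).
  change (winv (fword (rel_r a eps (gen_ord k./2))) = mkseq (fun p =>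
    named (linv (letter_of k./2 (face_len k./2 - 1 - p)))) (face_len k./2)).
  rewrite fword_rel_r winv_mkseq /= -[in RHS]kE.
  by apply: eq_mkseq => p; rewrite /linv.
change (fword (rel_r a eps (gen_ord k./2)) =
  mkseq (fun p => named (letter_of k./2 p)) (face_len k./2)).
by rewrite fword_rel_r -[in RHS]kE.
Qed.

(** Each factor r_i (x_i^-1 r_i^-1 x_i) equals P_i^-A P_(i+1)^A, because the
    power of x_i in r_i commutes with x_i and P_i x_i = x_i P_(i+1).  The product
    telescopes around the cycle. *)
Lemma psi_W : psi (rel_r a eps) (W n) = 1%g.
Proof.
rewrite /psi /W gmulf_prod /=.
transitivity (\prod_(i < n) (cycle_prod i ^- A * cycle_prod i.+1 ^+ A))%g.
  apply: eq_bigr => i _.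
  transitivity (rel_r a eps i * ((fgen i)^-1 * (rel_r a eps i)^-1 * fgen i))%g.
    rewrite !gmulfM !gmulfV.
    by congr (_ * (_^-1 * _^-1 * _))%g; exact: flift_gen.
  rewrite rel_rE; set y := (signed _ _ ^+ _)%g.
  have xy : commute (fgen i) y.
    by apply/commuteX; rewrite /signed; case: (gen_pos i); [|apply/commuteV].
  have cS : (cycle_prod i ^+ A * fgen i = fgen i * cycle_prod i.+1 ^+ A)%g.
    have := cycle_prodS n' i; rewrite modn_small // gen_ordK => e.
    elim: A => [|m IH]; first by rewrite !expg0 mul1g mulg1.
    by rewrite expgSr -mulgA e mulgA IH -mulgA -expgSr.
  rewrite invgM invgK -!mulgA cS; congr (_ * _)%g.
  have yx : (y * (fgen i)^-1 = (fgen i)^-1 * y)%g by apply/commuteV/commute_sym.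
  by rewrite [LHS]mulgA yx -mulgA mulVKg mulKg.
suff tele m : (\prod_(0 <= i < m) (cycle_prod i ^- A * cycle_prod i.+1 ^+ A))%g =
    (cycle_prod 0 ^- A * cycle_prod m ^+ A)%g.
  rewrite -(big_mkord xpredT (fun i => cycle_prod i ^- A * cycle_prod i.+1 ^+ A)%g) tele.
  rewrite (_ : cycle_prod n = cycle_prod 0) ?mulVg //.
  by apply: eq_bigr => k _; rewrite modnDl.
elim: m => [|m IH]; first by rewrite big_nil mulVg.
by rewrite big_nat_recr //= IH !mulgA mulgK.
Qed.

Lemma is_identity_W : is_identity (rel_r a eps) (W n).
Proof. by split; [exact: psi_W|exists (W_factors n); exact: W_factors_val]. Qed.

End Relators.

(** * Presentations of finite groups *)

Section Congruence.
Variables (T : choiceType) (rels : set (free_group T)).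
Local Notation F := (free_group T).
Local Notation N := (normal_closure rels).
Implicit Types u v : F.

Lemma normal_closureP : normal_subgroup N.
Proof.
split.
- by move=> M [[]].
- move=> g h Ng Nh M MP; have [[_ + _] _] := MP.
  by apply; [exact: Ng|exact: Nh].
- move=> g h Ng M MP; have [[_ _ +] _] := MP.
  by apply; exact: Ng.
Qed.

Lemma normal_closure_rel u : rels u -> N u.
Proof. by move=> ru M [_]; apply. Qed.

(** Equality in the presented group. *)
Definition eqmod u v : Prop := N (u^-1 * v)%g.

Lemma eqmod_refl u : eqmod u u.
Proof. by rewrite /eqmod mulVg; have [] := normal_closureP. Qed.

Lemma eqmod_sym u v : eqmod u v -> eqmod v u.
Proof.
have [N1 ND _] := normal_closureP; move=> uv.
by have := ND _ _ N1 uv; rewrite mul1g invgM invgK.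
Qed.

Lemma eqmodM u u' v v' : eqmod u u' -> eqmod v v' -> eqmod (u * v)%g (u' * v')%g.
Proof.
have [N1 ND NJ] := normal_closureP; move=> uu vv; rewrite /eqmod.
have -> : ((u * v)^-1 * (u' * v') =
    (v^-1 * (u^-1 * u') * v^-1^-1) * ((v^-1 * v')^-1)^-1)%g.
  by rewrite !invgK invgM !mulgA mulgK.
by apply: (ND _ _ (NJ _ _ uu)); have := ND _ _ N1 vv; rewrite mul1g.
Qed.

Lemma eqmodV u v : eqmod u v -> eqmod u^-1%g v^-1%g.
Proof.
have [N1 ND NJ] := normal_closureP; move=> uv; rewrite /eqmod invgK.
have := ND _ _ N1 (NJ _ u uv).
by rewrite mul1g mulgA mulgV mul1g invgM invgK.
Qed.

Lemma eqmod_trans u v w : eqmod u v -> eqmod v w -> eqmod u w.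
Proof.
have [N1 ND _] := normal_closureP; rewrite /eqmod => uv vw.
have -> : (u^-1 * w = (u^-1 * v) * ((v^-1 * w)^-1)^-1)%g.
  by rewrite invgK mulgA mulgK.
by apply: (ND) => //; have := ND _ _ N1 vw; rewrite mul1g.
Qed.

Lemma eqmodX u v m : eqmod u v -> eqmod (u ^+ m)%g (v ^+ m)%g.
Proof.
move=> uv; elim: m => [|m IH]; first exact: eqmod_refl.
by rewrite !expgS; exact: eqmodM.
Qed.

Lemma eqmod_rel u v : rels (u * v)%g -> eqmod v u^-1%g.
Proof.
move=> ru; apply: eqmod_sym; rewrite /eqmod invgK; exact: normal_closure_rel.
Qed.

(** The presented group is cyclic of order dividing m: every letter, including
    an inverse letter, is a power of g with a natural exponent. *)
Lemma finite_cyclic_presentation (g : F) (m : nat) : (0 < m)%N ->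
  eqmod (g ^+ m)%g 1%g -> (forall x, exists k, eqmod (fgen x) (g ^+ k)%g) ->
  finite_set (presented_group rels).
Proof.
move=> m0 gm1 gens.
have gmX k : eqmod (g ^+ (m * k))%g 1%g.
  by rewrite expgnA -[X in eqmod _ X](expg1n _ k); exact: eqmodX.
have letters (c : T * bool) : exists k, eqmod (signed (fgen c.1) c.2) (g ^+ k)%g.
  case: c => x b; have [k xk] := gens x; case: b => /=; first by exists k.
  exists ((m - 1) * k)%N; apply: (eqmod_trans (eqmodV xk)).
  have gk : (g ^+ (m * k) = g ^+ k * g ^+ ((m - 1) * k))%g.
    by rewrite -expgnDr; congr (g ^+ _)%g; nia.
  apply: eqmod_sym; have := gmX k; rewrite gk => h.
  by have := eqmodM (eqmod_refl (g ^+ k)^-1%g) h; rewrite mulKg mulg1.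
have powers u : exists2 k, (k < m)%N & eqmod u (g ^+ k)%g.
  have [k uk] : exists k, eqmod u (g ^+ k)%g.
    have -> : u = wprod (fword u) by apply: val_inj; rewrite /= fword_wprod // (valP u).
    elim: (fword u) => [|c w [k wk]]; first by exists 0%N; rewrite /wprod big_nil; exact: eqmod_refl.
    have [k' ck] := letters c; exists (k' + k)%N.
    by rewrite /wprod big_cons expgnDr; exact: eqmodM.
  exists (k %% m)%N; first exact: ltn_pmod.
  apply: (eqmod_trans uk); rewrite {1}(divn_eq k m) expgnDr mulnC.
  by have := eqmodM (gmX (k %/ m)) (eqmod_refl (g ^+ (k %% m))%g); rewrite mul1g.
pose coset u : set F := [set h | eqmod u h].
apply: (@sub_finite_set _ _ ((fun k => coset (g ^+ k)%g) @` `I_m)); last first.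
  by apply: finite_image; exact: finite_II.
move=> _ [u _ <-]; have [k km uk] := powers u; exists k => //.
apply/seteqP; split => h /=; first exact: eqmod_trans uk.
by apply: eqmod_trans; exact: eqmod_sym.
Qed.

End Congruence.

(** Here the only generators are x_0 and h, and the relators x_0 and x_0^a h kill
    both. *)
Lemma seifert_pi1_finite0 (a : 'I_1 -> nat) (eps : 'I_0 -> int) :
  finite_set (seifert_pi1 a eps).
Proof.
apply: (@finite_cyclic_presentation _ _ 1%g 1) => //.
  by rewrite expg1n; exact: eqmod_refl.
have x1 i : eqmod (seifert_relator a eps) (seifert_x i) 1%g.
  have := seifert_total a eps; rewrite big_ord1 (ord1 i) => h.
  by apply: eqmod_sym; rewrite /eqmod invg1 mul1g; exact: normal_closure_rel.
case=> [i|]; exists 0%N; first exact: x1.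
apply: (eqmod_trans (eqmod_rel (seifert_last a eps))).
rewrite expg0 -[X in eqmod _ _ X]invg1; apply: eqmodV.
by rewrite -[X in eqmod _ _ X](expg1n _ (a ord_max)); apply: eqmodX.
Qed.

(** The relators give x_1 = x_0^-1 and h = x_1^(-a_1) = x_0^(a_1), so the
    relator x_0^(a_0) h becomes x_0^(a_0 + a_1). *)
Lemma seifert_pi1_finite1 (a : 'I_2 -> nat) (eps : 'I_1 -> int) :
  (0 < a ord_max)%N -> eps ord0 = 1%R -> finite_set (seifert_pi1 a eps).
Proof.
move=> a0 e1; set rels := seifert_relator a eps.
pose x : free_group (option 'I_2) := seifert_x (emb ord0).
have x2 : eqmod rels (seifert_x ord_max) x^-1%g.
  apply: eqmod_rel; have := seifert_total a eps.
  rewrite big_ord_recl big_ord1 (_ : lift ord0 ord0 = ord_max); last exact: val_inj.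
  by have -> : ord0 = emb ord0 :> 'I_2 by exact: val_inj.
have h1 : eqmod rels (seifert_h 1) (x ^+ a ord_max)%g.
  apply: (eqmod_trans (eqmod_rel (seifert_last a eps))).
  have -> : (x ^+ a ord_max = (x^-1 ^+ a ord_max)^-1)%g by rewrite expVgn invgK.
  by apply: eqmodV; apply: eqmodX; exact: x2.
pose m := (a (emb ord0) + a ord_max)%N.
have m0 : (0 < m)%N by rewrite addn_gt0 a0 orbT.
have xm : eqmod rels (x ^+ m)%g 1%g.
  have r1 := seifert_fiber a eps ord0; rewrite e1 /= expg1 in r1.
  rewrite expgnDr; apply: (@eqmod_trans _ _ _ (x ^+ a (emb ord0) * seifert_h 1)%g).
    by apply: eqmodM; [exact: eqmod_refl|exact: eqmod_sym h1].
  apply: eqmod_sym; rewrite /eqmod invg1 mul1g; exact: normal_closure_rel.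
apply: (@finite_cyclic_presentation _ _ x m) => //.
case=> [i|]; last by exists (a ord_max).
have [->|->] : i = emb ord0 \/ i = ord_max.
  by case: i => -[|[|//]] i2; [left|right]; exact: val_inj.
  by exists 1%N; exact: eqmod_refl.
exists m.-1; apply: (eqmod_trans x2); apply: eqmod_sym.
have := eqmodM (@eqmod_refl _ rels x^-1%g) xm.
by rewrite -[in X in eqmod _ X](prednK m0) expgS mulKg mulg1.
Qed.

Lemma seifert_pi1_infinite_eps (n' : nat) (a : 'I_n'.+2 -> nat) (eps : 'I_n'.+1 -> int) :
  (forall i, 2 <= a i)%N -> (forall i, eps i = 1%R \/ eps i = (-1)%R) ->
  infinite_set (seifert_pi1 a eps) -> n'.+1 = 1%N -> forall i, eps i = (-1)%R.
Proof.
move=> a2 e1 inf [n0] i; subst n'.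
case: (e1 i) => // ei; case: inf; apply: seifert_pi1_finite1.
  by apply: ltnW; exact: a2.
by rewrite -ei (ord1 i).
Qed.


(** * The identity W is taut *)

Section Assembly.
Variable R : realType.
Variable n' : nat.
Local Notation n := n'.+1.
Variables (a : 'I_n.+1 -> nat) (eps : 'I_n -> int).
Hypothesis a_ge2 : forall i, (2 <= a i)%N.
Hypothesis eps_pm1 : forall i, eps i = 1%R \/ eps i = (-1)%R.
Hypothesis eps_one : n = 1%N -> forall i, eps i = (-1)%R.

Lemma taut_W : taut R (rel_r a eps) (W_factors n).
Proof.
split; first by rewrite size_W_factors mul2n.
have gp : forall j, gen_pos eps j -> (1 < n)%N by exact: gen_pos_lt.
have [I [sI hI [kappa [lambda kl]]]] :=
  @gluing_taut R n (last_exp a) (gen_exp a) (gen_pos eps) (ltn0Sn n')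
    (last_exp_ge2 a_ge2) (gen_exp_ge2 a_ge2) gp _ (@gen_ord n') _
    (fun k => fword (factor_rel (rel_r a eps) (tnth (in_tuple (W_factors n)) k)))
    (size_W_factors n') (fword_factor_rel a_ge2 eps_pm1 eps_one).
exists I; split => //; exists kappa, lambda => k.
by have [] := kl k; rewrite /conj_word -(fword_fconj k).
Qed.

End Assembly.


Close Scope classical_set_scope.
Local Open Scope ring_scope.

Theorem proposition3p11 (R : realType) (n : nat)
    (a : 'I_n.+1 -> nat) (eps : 'I_n -> int)
    (a_ge2 : forall i, (2 <= a i)%N)
    (eps_pm1 : forall i, eps i = 1 \/ eps i = -1)
    (pi1_infinite : infinite_set (seifert_pi1 a eps)) :
  taut_identity R (rel_r a eps) (W n) (W_factors n).
Proof.
case: n a eps a_ge2 eps_pm1 pi1_infinite => [|n'] a eps a_ge2 eps_pm1 inf.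
  by case: inf; exact: seifert_pi1_finite0.
have eps_one := seifert_pi1_infinite_eps a_ge2 eps_pm1 inf.
split; [exact: is_identity_W|exact: W_factors_val|exact: taut_W].
Qed.
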